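(* Let $p$ be a prime. For $r\in\mathbb{N}_{>1}$, let $k_1,\ldots,k_r\in\mathbb{Z}$ with $k_1+\cdots+k_r\not\equiv r\pmod2$, $\gamma_1\in\mathbb{Z}_p$, $\gamma_2,\ldots,\gamma_r\in p\mathbb{Z}_p$ and $c\in\mathbb{Z}_p^\times$. Then, for $s_1,\ldots,s_r\in\mathbb{Z}_p$, \begin{align*} &L_{p,r}(s_1,\ldots,s_r;\omega^{k_1},\ldots,\omega^{k_r};\gamma_1,\gamma_2,\ldots,\gamma_r;c)\\ &=-\sum_{\substack{J\subsetneq\{1,\ldots,r\}\\1\in J}}\Bigl(\frac{1-c}{2}\Bigr)^{r-|J|}L_{p,|J|}\Bigl(\Bigl(\sum_{j_\mu(J)\leqslant l<j_{\mu+1}(J)}s_l\Bigr)_{\mu=1}^{|J|};\Bigl(\omega^{\sum_{j_\mu(J)\leqslant l<j_{\mu+1}(J)}k_l}\Bigr)_{\mu=1}^{|J|};(\gamma_j)_{j\in J};c\Bigr). \end{align*}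
   Context: For $J\subset\{1,\ldots,r\}$ with $1\in J$ write $J=\{j_1(J),\ldots,j_{|J|}(J)\}$ with $1=j_1(J)<\cdots<j_{|J|}(J)$, where $|J|$ is the number of elements, and put $j_{|J|+1}(J)=r+1$. The family $(\gamma_j)_{j\in J}$ is listed in increasing order of $j$. Put $q=4$ if $p=2$ and $q=p$ if $p\geqslant3$. Let $W=\{\pm1\}$ if $p=2$ and $W=\{\xi\in\mathbb{Z}_p^\times\mid\xi^{p-1}=1\}$ if $p\geqslant3$. Every $x\in\mathbb{Z}_p^\times$ is uniquely $x=\omega(x)\langle x\rangle$ with $\omega(x)\in W$, $\langle x\rangle\in1+q\mathbb{Z}_p$. For $c\in\mathbb{Z}_p^\times$, $\widetilde{\mathfrak{m}}_c$ is the $\mathbb{Z}_p$-valued measure on $\mathbb{Z}_p$ corresponding to $$g_c(T)=\frac{1}{(1+T)-1}-\frac{c}{(1+T)^c-1}\in\mathbb{Z}_p[[T]]$$ under the identification of $\mathbb{Z}_p$-valued measures on $\mathbb{Z}_p$ with $\mathbb{Z}_p[[\mathbb{Z}_p]]\simeq\mathbb{Z}_p[[T]]$, $1\mapsto1+T$; that is, $\int_{\mathbb{Z}_p}(1+T)^xd\widetilde{\mathfrak{m}}_c(x)=g_c(T)$. (For $c\in\mathbb{N}_{>1}$ prime to $p$, $\widetilde{\mathfrak{m}}_c(j+p^N\mathbb{Z}_p)=\sum_{\xi^c=1,\,\xi\neq1}\xi^j/(1-\xi^{p^N})$ for $0\leqslant j\leqslant p^N-1$.) For $\rho\in\mathbb{N}$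 and $\gamma_1,\ldots,\gamma_\rho\in\mathbb{Z}_p$ put $(\mathbb{Z}_p^\rho)'_{\{\gamma_j\}}=\{(x_j)\in\mathbb{Z}_p^\rho\mid p\nmid x_1\gamma_1,\ p\nmid(x_1\gamma_1+x_2\gamma_2),\ldots,\ p\nmid\sum_{j=1}^\rho x_j\gamma_j\}$. For $k_j\in\mathbb{Z}$ and $s_j\in\mathbb{Z}_p$ the $p$-adic multiple $L$-function of depth $\rho$ is $$L_{p,\rho}(s_1,\ldots,s_\rho;\omega^{k_1},\ldots,\omega^{k_\rho};\gamma_1,\ldots,\gamma_\rho;c)=\int_{(\mathbb{Z}_p^\rho)'_{\{\gamma_j\}}}\prod_{i=1}^\rho\Bigl\langle\sum_{j=1}^ix_j\gamma_j\Bigr\rangle^{-s_i}\omega^{k_i}\Bigl(\sum_{j=1}^ix_j\gamma_j\Bigr)\prod_{j=1}^\rho d\widetilde{\mathfrak{m}}_c(x_j),$$ the zero function if the domain is empty. *)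

(* Defs.v *)
From HB Require Import structures.
From mathcomp Require Import all_boot all_order all_algebra.
From mathcomp Require Import all_classical topology.
Set Implicit Arguments.
Unset Strict Implicit.
Unset Printing Implicit Defensive.
Import Order.TTheory GRing.Theory.
Local Open Scope classical_set_scope.
Local Open Scope ring_scope.

(* Z_p is the inverse limit of the rings Z/p^n: an element is a compatible
   sequence of residues, [residue x n] being the representative of x mod p^n
   in {0, ..., p^n - 1}. *)
Record padic_int (p : nat) (p_pr : prime p) := PadicInt {
  residue : nat -> nat;
  residue_mod : forall n, residue n = (residue n.+1 %% p ^ n)%N }.

Section PadicRing.
Variables (p : nat) (p_pr : prime p).
Local Notation Zp := (padic_int p_pr).
Implicit Types x y z : Zp.

HB.instance Definition _ := gen_eqMixin Zp.
HB.instance Definition _ := gen_choiceMixin Zp.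

Lemma residue_inj x y : residue x =1 residue y -> x = y.
Proof.
case: x y => [f fP] [g gP] /= /funext efg; move: gP; rewrite -efg => gP.
by congr PadicInt; apply: Prop_irrelevance.
Qed.

Lemma residue_small x n : (residue x n %% p ^ n = residue x n)%N.
Proof. by rewrite (residue_mod x n) modn_mod. Qed.

Lemma padic_of_proof (f : nat -> nat) :
    (forall n, f n.+1 = f n %[mod p ^ n])%N ->
  forall n, (f n %% p ^ n = (f n.+1 %% p ^ n.+1) %% p ^ n)%N.
Proof. by move=> fP n; rewrite modn_dvdm ?fP // dvdn_exp2l. Qed.

Definition padic_of f fP : Zp := PadicInt p_pr (@padic_of_proof f fP).

Lemma residueS x n : (residue x n.+1 = residue x n %[mod p ^ n])%N.
Proof. by rewrite [residue x n]residue_mod modn_mod. Qed.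

Lemma padic_nat_proof (m n : nat) : (m = m %[mod p ^ n])%N. Proof. by []. Qed.

Lemma padic_add_proof x y n :
  (residue x n.+1 + residue y n.+1 = residue x n + residue y n %[mod p ^ n])%N.
Proof. by rewrite -modnDm !residueS modnDm. Qed.

Lemma padic_mul_proof x y n :
  (residue x n.+1 * residue y n.+1 = residue x n * residue y n %[mod p ^ n])%N.
Proof. by rewrite -modnMm !residueS modnMm. Qed.

Lemma residue_le x n : (residue x n <= p ^ n)%N.
Proof. by rewrite -residue_small ltnW // ltn_mod expn_gt0 prime_gt0. Qed.

Lemma padic_opp_proof x n :
  (p ^ n.+1 - residue x n.+1 = p ^ n - residue x n %[mod p ^ n])%N.
Proof.
apply/eqP; rewrite -(eqn_modDr (residue x n)) subnK ?residue_le //.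
rewrite -[X in X == _]modnDmr -residueS modnDmr subnK ?residue_le //.
by rewrite modnn expnS modnMl.
Qed.

Definition padic_nat m : Zp := padic_of (padic_nat_proof m).
Definition padic_add x y : Zp := padic_of (padic_add_proof x y).
Definition padic_mul x y : Zp := padic_of (padic_mul_proof x y).
Definition padic_opp x : Zp := padic_of (padic_opp_proof x).

Lemma padic_addA : associative padic_add.
Proof. by move=> x y z; apply: residue_inj => n /=; rewrite modnDml modnDmr addnA. Qed.

Lemma padic_addC : commutative padic_add.
Proof. by move=> x y; apply: residue_inj => n /=; rewrite addnC. Qed.

Lemma padic_add0 : left_id (padic_nat 0) padic_add.
Proof. by move=> x; apply: residue_inj => n /=; rewrite mod0n residue_small. Qed.

Lemma padic_addN : left_inverse (padic_nat 0) padic_opp padic_add.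
Proof.
move=> x; apply: residue_inj => n /=.
by rewrite modnDml subnK ?residue_le // modnn mod0n.
Qed.

HB.instance Definition _ :=
  GRing.isZmodule.Build Zp padic_addA padic_addC padic_add0 padic_addN.

Lemma padic_mulA : associative padic_mul.
Proof. by move=> x y z; apply: residue_inj => n /=; rewrite modnMml modnMmr mulnA. Qed.

Lemma padic_mulC : commutative padic_mul.
Proof. by move=> x y; apply: residue_inj => n /=; rewrite mulnC. Qed.

Lemma padic_mul1 : left_id (padic_nat 1) padic_mul.
Proof.
by move=> x; apply: residue_inj => n /=; rewrite modnMml mul1n residue_small.
Qed.

Lemma padic_mulD : left_distributive padic_mul padic_add.
Proof.
move=> x y z; apply: residue_inj => n /=.
by rewrite modnMml mulnDl modnDm.
Qed.

Lemma padic_1_neq0 : padic_nat 1 != 0.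
Proof.
apply/eqP => /(congr1 (fun x => residue x 1)) /=.
by rewrite expn1 mod0n modn_small ?prime_gt1.
Qed.

HB.instance Definition _ := GRing.Zmodule_isComNzRing.Build Zp
  padic_mulA padic_mulC padic_mul1 padic_mulD padic_1_neq0.

Lemma residueD x y n : residue (x + y) n = ((residue x n + residue y n) %% p ^ n)%N.
Proof. by []. Qed.

Lemma residueM x y n : residue (x * y) n = ((residue x n * residue y n) %% p ^ n)%N.
Proof. by []. Qed.

Lemma residue0 n : residue (0 : Zp) n = 0%N.
Proof. by rewrite /= mod0n. Qed.

Lemma residue_nat m n : residue (m%:R : Zp) n = (m %% p ^ n)%N.
Proof.
elim: m => [|m IHm]; first by rewrite residue0 mod0n.
by rewrite mulrSr residueD IHm /= modnDm addn1.
Qed.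

Definition padic_unit : pred Zp := fun x => `[< exists y, y * x = 1 >].
Definition padic_inv x : Zp := xget x [set y | y * x = 1].

Lemma padic_mulV : {in padic_unit, left_inverse 1 padic_inv *%R}.
Proof. by move=> x /asboolP [y yx]; rewrite /padic_inv; case: xgetP => // /(_ y). Qed.

Lemma padic_unitP x y : y * x = 1 -> padic_unit x.
Proof. by move=> yx; apply/asboolP; exists y. Qed.

Lemma padic_inv_out : {in [predC padic_unit], padic_inv =1 id}.
Proof.
move=> x /negP xNU; rewrite /padic_inv; case: xgetP => // y _ yx.
by case: xNU; apply: padic_unitP yx.
Qed.

HB.instance Definition _ := GRing.ComNzRing_hasMulInverse.Build Zp
  padic_mulV padic_unitP padic_inv_out.

Lemma padic_neq0 x : x != 0 -> exists n, forall m, (n <= m)%N ->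
  (0 < residue x m)%N /\ (logn p (residue x m) < n)%N.
Proof.
move=> x0; have [n xn] : exists n, residue x n != 0%N.
  apply: contrapT => xE; case/eqP: x0; apply: residue_inj => n.
  rewrite residue0; apply: contrapT => /eqP xn; apply: xE.
  by exists n.
have Ediv m : (n <= m)%N -> (residue x m %% p ^ n = residue x n)%N.
  elim: m => [|m IHm]; first by rewrite leqn0 => /eqP ->; rewrite residue_small.
  rewrite leq_eqVlt => /predU1P[->|]; first by rewrite residue_small.
  rewrite ltnS => nm.
  by rewrite -[RHS]IHm // (residue_mod x m) modn_dvdm // dvdn_exp2l.
exists n => m /Ediv Em; have : ~~ (p ^ n %| residue x m)%N by rewrite /dvdn Em.
have [-> | xm] := posnP (residue x m); first by rewrite dvdn0.
by rewrite pfactor_dvdn // -ltnNge.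
Qed.

Lemma padic_integral : GRing.integral_domain_axiom Zp.
Proof.
move=> x y /eqP xy0; apply/contraT; rewrite negb_or => /andP[].
move=> /padic_neq0[n nP] /padic_neq0[m mP].
have [x_gt0 xn] := nP (n + m)%N (leq_addr _ _).
have [y_gt0 ym] := mP (n + m)%N (leq_addl _ _).
move/eqP: xy0 => /(congr1 (fun x => residue x (n + m))).
rewrite residueM residue0 => /eqP.
rewrite -/(_ %| _)%N pfactor_dvdn ?muln_gt0 ?x_gt0 // lognM // leqNgt.
by rewrite -addSn leq_add // ltnW.
Qed.

HB.instance Definition _ := GRing.ComUnitRing_isIntegral.Build Zp padic_integral.

HB.instance Definition _ := isPointed.Build Zp 0.

(* The inverse limit topology, i.e. the p-adic one: the topology induced by the
   product of the discrete spaces of residues. *)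
HB.instance Definition _ := Topological.copy Zp
  (initial_topology (@residue p p_pr : Zp -> prod_topology (fun _ : nat => nat))).

Lemma cvg_padicP (u : nat -> Zp) x :
  u n @[n --> \oo] --> x <->
  forall m, \forall n \near \oo, residue (u n) m = residue x m.
Proof.
set X := residue x : prod_topology (fun _ : nat => nat).
set U := (fun n => residue (u n)) : nat -> prod_topology (fun _ : nat => nat).
have ptwsP : U n @[n --> \oo] --> X <->
    forall m, \forall n \near \oo, residue (u n) m = residue x m.
  have FU : Filter (U n @[n --> \oo]) by apply: fmap_filter.
  have cvgP := @pointwise_cvgP nat nat _ X FU; split.
    by move=> /cvgP UX m; apply: (UX m [set residue x m]).
  move=> H; apply/cvgP => m A /= XA.
  have := H m; apply: filterS => n /= E.
  by rewrite /U E; exact: nbhs_singleton XA.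
rewrite -ptwsP; split=> [ux A XA|UX A].
  exact: ux _ (@initial_continuous Zp _ (@residue p p_pr : Zp -> prod_topology _) x A XA).
move=> [_ [[B Bop <-] xB] BA]; have /UX : nbhs X B by exact: open_nbhs_nbhs.
move=> UB; change (\forall n \near \oo, A (u n)).
by apply: (@filterS _ \oo _ (U @^-1` B)) UB => n UnB; apply: BA.
Qed.

End PadicRing.

(* [a n] is the coefficient of T^n. *)
Definition pseries (R : Type) := nat -> R.

Section PowerSeries.
Variable R : idomainType.
Local Notation PS := (pseries R).
Implicit Types a b c : PS.

HB.instance Definition _ := GRing.Zmodule.copy PS (nat -> R).

Definition ps_const (x : R) : PS := fun n => if n == 0%N then x else 0.
Definition ps_T : PS := fun n => (n == 1%N)%:R.
Definition ps_mul a b : PS := fun n => \sum_(i < n.+1) a i * b (n - i)%N.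

Let tr (m : nat) a : {poly R} := \poly_(i < m) a i.

Let ps_mul_tr m a b n : (n < m)%N -> ps_mul a b n = (tr m a * tr m b)`_n.
Proof.
move=> nm; rewrite coefM; apply: eq_bigr => i _.
by rewrite !coef_poly (leq_trans (ltn_ord i) nm) (leq_ltn_trans (leq_subr i n) nm).
Qed.

Lemma ps_mulC : commutative ps_mul.
Proof. by move=> a b; apply/funext => n; rewrite !(@ps_mul_tr n.+1) // mulrC. Qed.

Let ps_mul3_tr a b c n :
  ps_mul (ps_mul a b) c n = (tr n.+1 a * tr n.+1 b * tr n.+1 c)`_n.
Proof.
rewrite coefM; apply: eq_bigr => i _.
by rewrite (@ps_mul_tr n.+1) // [in RHS]coef_poly ltnS leq_subr.
Qed.

Lemma ps_mulA : associative ps_mul.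
Proof.
move=> a b c; apply/funext => n.
by rewrite ps_mulC !ps_mul3_tr [in LHS]mulrC mulrA.
Qed.

Lemma ps_mul1 : left_id (ps_const 1) ps_mul.
Proof.
move=> a; apply/funext => n; rewrite /ps_mul big_ord_recl /= subn0 mul1r.
by rewrite big1 ?addr0 // => i _; rewrite /ps_const /= mul0r.
Qed.

Lemma ps_mulD : left_distributive ps_mul +%R.
Proof.
move=> a b c; apply/funext => n.
transitivity (ps_mul a c n + ps_mul b c n); last by [].
rewrite /ps_mul -big_split /=; apply: eq_bigr => i _.
exact: mulrDl.
Qed.

Lemma ps_const1_neq0 : ps_const 1 != 0 :> PS.
Proof. by apply/eqP => /(congr1 (@^~ 0%N)) /eqP; apply/negP/oner_neq0. Qed.

HB.instance Definition _ := GRing.Zmodule_isComNzRing.Build PS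
  ps_mulA ps_mulC ps_mul1 ps_mulD ps_const1_neq0.

Definition ps_unit : pred PS := fun a => `[< exists b, b * a = 1 >].
Definition ps_inv a : PS := xget a [set b | b * a = 1].

Lemma ps_mulV : {in ps_unit, left_inverse 1 ps_inv *%R}.
Proof. by move=> a /asboolP [b ba]; rewrite /ps_inv; case: xgetP => // /(_ b). Qed.

Lemma ps_unitP a b : b * a = 1 -> ps_unit a.
Proof. by move=> ba; apply/asboolP; exists b. Qed.

Lemma ps_inv_out : {in [predC ps_unit], ps_inv =1 id}.
Proof.
move=> a /negP aNU; rewrite /ps_inv; case: xgetP => // b _ ba.
by case: aNU; apply: ps_unitP ba.
Qed.

HB.instance Definition _ := GRing.ComNzRing_hasMulInverse.Build PS
  ps_mulV ps_unitP ps_inv_out.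

Lemma ps_neq0 a : a != 0 ->
  exists n, a n != 0 /\ forall m, (m < n)%N -> a m = 0.
Proof.
move=> a0; have exa : exists n, a n != 0.
  apply: contrapT => aE; case/eqP: a0; apply/funext => n.
  by apply: contrapT => /eqP an; apply: aE; exists n.
exists (ex_minn exa); case: ex_minnP => n an minn; split=> // m mn.
by apply/eqP; apply: contraTT mn => /minn; rewrite -leqNgt.
Qed.

Lemma ps_integral : GRing.integral_domain_axiom PS.
Proof.
move=> a b /eqP ab0; apply/contraT; rewrite negb_or => /andP[].
move=> /ps_neq0[n [an minn]] /ps_neq0[m [bm minm]].
move/eqP: ab0 => /(congr1 (@^~ (n + m)%N)) /=.
have nm : (n < (n + m).+1)%N by rewrite ltnS leq_addr.
rewrite [LHS](bigD1 (Ordinal nm)) //= addKn big1 => [/eqP|i].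
  by rewrite addr0 mulf_eq0 (negPf an) (negPf bm).
rewrite -val_eqE /= neq_ltn => /orP[/minn->|ni]; first by rewrite mul0r.
by rewrite minm ?mulr0 // ltn_subLR ?ltn_add2r // -ltnS ltn_ord.
Qed.

HB.instance Definition _ := GRing.ComUnitRing_isIntegral.Build PS ps_integral.

End PowerSeries.

(* The field Q_p is {fraction padic_int p_pr}. *)
Notation "x %:F" := (tofrac x) : ring_scope.

Section PadicFunctions.
Variables (p : nat) (p_pr : prime p).
Local Notation Zp := (padic_int p_pr).

Definition pdvd (x : Zp) : Prop := exists y : Zp, x = p%:R * y.

(* binom(x, n) = x (x - 1) ... (x - n + 1) / n!, an exact division in Z_p. Here
   and below, xget picks the unique element of a set; its default is irrelevant. *)
Definition binomial_padic (x : Zp) (n : nat) : Zp :=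
  xget 0 [set b | n`!%:R * b = \prod_(i < n) (x - i%:R)].

(* (1 + T)^x = sum_n binom(x, n) T^n *)
Definition one_plus_T_pow (x : Zp) : pseries Zp := binomial_padic x.

(* y^s for y in 1 + q Z_p: the limit of y^m for natural m tending p-adically to s *)
Definition pow_padic (y s : Zp) : Zp := lim (y ^+ residue s n @[n --> \oo]).

Definition q_of : nat := if p == 2 then 4 else p.

Definition group_W : set Zp :=
  [set w | if p == 2 then w = 1 \/ w = -1
           else w \is a GRing.unit /\ w ^+ p.-1 = 1].

(* x = omega(x) <x>; the values at non-units x are irrelevant *)
Definition omega (x : Zp) : Zp :=
  xget 1 [set w | group_W w /\ exists y : Zp, x = w * (1 + q_of%:R * y)].
Definition angle (x : Zp) : Zp := x / omega x.

(* A Z_p-valued measure on Z_p, i.e. an element of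
   Z_p[[Z_p]] = lim_N Z_p[Z/p^N]: [mu N j] is the measure of j + p^N Z_p. *)
Record padic_measure := PadicMeasure {
  ball_measure :> forall N : nat, 'I_(p ^ N) -> Zp;
  ball_measureS : forall (N : nat) (j : 'I_(p ^ N)),
    ball_measure j =
    \sum_(i < p ^ N.+1 | (i %% p ^ N)%N == j :> nat) ball_measure i }.

HB.instance Definition _ := gen_eqMixin padic_measure.
HB.instance Definition _ := gen_choiceMixin padic_measure.

Lemma measure0_proof (N : nat) (j : 'I_(p ^ N)) :
  0 = \sum_(i < p ^ N.+1 | (i %% p ^ N)%N == j :> nat) 0 :> Zp.
Proof. by rewrite big1. Qed.

Definition measure0 : padic_measure :=
  @PadicMeasure (fun _ _ => 0) measure0_proof.

(* The integral of a continuous f : Z_p^rho -> Z_p against mu x ... x mu: the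
   limit of the Riemann sums over the boxes prod_j (a_j + p^N Z_p). *)
Definition riemann_sum (rho : nat) (mu : padic_measure)
    (f : ('I_rho -> Zp) -> Zp) (N : nat) : Zp :=
  \sum_(a : {ffun 'I_rho -> 'I_(p ^ N)})
    f (fun j => (a j)%:R) * \prod_(j < rho) mu N (a j).

Definition integral_padic (rho : nat) (mu : padic_measure)
    (f : ('I_rho -> Zp) -> Zp) : Zp :=
  lim (riemann_sum mu f N @[N --> \oo]).

(* int_{Z_p} (1 + T)^x dmu(x) *)
Definition measure_series (mu : padic_measure) : pseries Zp :=
  fun n => integral_padic mu (fun x : 'I_1 -> Zp => one_plus_T_pow (x ord0) n).

Definition g_series (c : Zp) : pseries Zp :=
  xget 0 [set g : pseries Zp |
    g%:F = 1 / ((1 + ps_T Zp)%:F - 1)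
           - (ps_const c)%:F / ((one_plus_T_pow c)%:F - 1)].

Definition m_tilde (c : Zp) : padic_measure :=
  xget measure0 [set mu | measure_series mu = g_series c].

Section MultipleL.
Variable rho : nat.
Implicit Types (s gam x : 'I_rho -> Zp) (k : 'I_rho -> int) (i : 'I_rho).

Definition partial_sum gam x i : Zp := \sum_(j < rho | (j <= i)%N) x j * gam j.

Definition L_domain gam : set ('I_rho -> Zp) :=
  [set x | forall i, ~ pdvd (partial_sum gam x i)].

Definition L_integrand s k gam x : Zp :=
  \prod_(i < rho) (pow_padic (angle (partial_sum gam x i)) (- s i) *
                   omega (partial_sum gam x i) ^ k i).

(* The characters omega^(k_i) enter through the exponents k_i. *)
Definition L_padic s k gam (c : Zp) : Zp :=
  integral_padic (m_tilde c)
    (patch (fun=> 0) (L_domain gam) (L_integrand s k gam)).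

End MultipleL.

End PadicFunctions.

(* The sequence j_1(J), j_2(J), ..., counted from mu = 0 and with the elements
   of {1, ..., r} shifted to 0, ..., r - 1; it continues with the value r. *)
Definition jseq (r : nat) (J : {set 'I_r}) (mu : nat) : nat :=
  nth r [seq val j | j <- enum J] mu.

Definition block_sum (V : nmodType) (r : nat) (J : {set 'I_r}) (v : 'I_r -> V) :
    'I_#|J| -> V :=
  fun mu => \sum_(l < r | (jseq J mu <= l < jseq J mu.+1)%N) v l.

Definition subfamily (V : Type) (r : nat) (J : {set 'I_r}) (v : 'I_r -> V) :
    'I_#|J| -> V :=
  fun mu => v (enum_val mu).

Arguments block_sum {V r} J v mu.
Arguments subfamily {V r} J v mu.

(* Main.v *)
Require Import Defs.
From mathcomp Require Import all_boot all_order all_algebra.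
From mathcomp Require Import all_classical topology.
From mathcomp Require Import ring zify.
Import GRing.Theory.
Local Open Scope ring_scope.

(* By the reflection T |-> (1 + T)^-1 - 1 of g_c, the measure m_c satisfies
   m_c(-x) = (c - 1) delta_0 - m_c(x), so that nu = m_c + (1 - c)/2 delta_0 is odd.
   The integrand over the domain (Z_p^r)' is multiplied by (-1)^(k_1 + ... + k_r) when
   x is replaced by -x, hence its integral against nu^r vanishes under the parity
   hypothesis. Expanding nu^r, the coordinates outside J carry (1 - c)/2 delta_0: if 1 is
   not in J then x_1 = 0 lies outside the domain, and otherwise the partial sums
   are constant on the blocks of J, which leaves the L-function of depth |J|.

   The reflection is proved in the convolution algebra. Clearing denominators,
   m_c * (delta_1 - delta_0) * (delta_c - delta_0) = delta_c - delta_0 - c (delta_1 - delta_0)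
   (the transform of a measure determines it, by Mahler's theorem), and for a unit a
   the measure delta_a - delta_0 is not a zero divisor. *)

Set Implicit Arguments.
Unset Strict Implicit.
Unset Printing Implicit Defensive.

(** * Congruences and limits in Z_p *)

Section Residues.
Variables (p : nat) (p_pr : prime p).
Local Notation Zp := (padic_int p_pr).
Implicit Types (x y z : Zp) (m n N : nat).

Let p_gt1 : (1 < p)%N. Proof. exact: prime_gt1. Qed.
Let p_gt0 : (0 < p)%N. Proof. exact: prime_gt0. Qed.
Let pX_gt0 n : (0 < p ^ n)%N. Proof. by rewrite expn_gt0 p_gt0. Qed.

Lemma residue_lt x n : (residue x n < p ^ n)%N.
Proof. by rewrite -residue_small ltn_mod. Qed.

Lemma residue_leq x m n : (m <= n)%N -> residue x m = (residue x n %% p ^ m)%N.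
Proof.
elim: n => [|n IHn]; first by rewrite leqn0 => /eqP ->; rewrite residue_small.
rewrite leq_eqVlt => /predU1P[->|]; first by rewrite residue_small.
rewrite ltnS => mn; rewrite IHn // (residue_mod x n) modn_dvdm //.
exact: dvdn_exp2l.
Qed.

Lemma padic_natE m : m%:R = padic_nat p_pr m.
Proof. by apply: residue_inj => n; apply: residue_nat. Qed.

(** Congruence modulo p^n, encoded as an equality of residues so that symmetry and transitivity are
    those of equality. *)
Definition congp n x y := residue x n = residue y n.

Lemma congp_sym n x y : congp n x y -> congp n y x. Proof. by []. Qed.

Lemma congp_trans n x y z : congp n x y -> congp n y z -> congp n x z.
Proof. exact: etrans. Qed.

Lemma congp_leq m n x y : (m <= n)%N -> congp n x y -> congp m x y.
Proof. by rewrite /congp => mn E; rewrite !(residue_leq _ mn) E. Qed.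

Lemma congpD n x x' y y' : congp n x x' -> congp n y y' -> congp n (x + y) (x' + y').
Proof. by rewrite /congp !residueD => -> ->. Qed.

Lemma congpM n x x' y y' : congp n x x' -> congp n y y' -> congp n (x * y) (x' * y').
Proof. by rewrite /congp !residueM => -> ->. Qed.

Lemma congpN n x y : congp n x y -> congp n (- x) (- y).
Proof. by rewrite -[- x]mulN1r -[- y]mulN1r; apply: congpM. Qed.

Lemma congpB n x x' y y' : congp n x x' -> congp n y y' -> congp n (x - y) (x' - y').
Proof. by move=> xx' yy'; apply: congpD => //; apply: congpN. Qed.

Lemma congpX n x y e : congp n x y -> congp n (x ^+ e) (y ^+ e).
Proof. by move=> xy; elim: e => [//|e IHe]; rewrite !exprS; apply: congpM. Qed.

Lemma congp_sum n (I : Type) (r : seq I) (P : pred I) (f g : I -> Zp) :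
    (forall i, P i -> congp n (f i) (g i)) ->
  congp n (\sum_(i <- r | P i) f i) (\sum_(i <- r | P i) g i).
Proof. by move=> fg; apply: (big_ind2 (congp n)) => // *; apply: congpD. Qed.

Lemma congp_sum0 n (I : Type) (r : seq I) (P : pred I) (f : I -> Zp) :
  (forall i, P i -> congp n (f i) 0) -> congp n (\sum_(i <- r | P i) f i) 0.
Proof.
move=> f0; apply: (big_ind (fun t => congp n t 0)) => // x y x0 y0.
by rewrite -[X in congp _ _ X](addr0 0); apply: congpD.
Qed.

Lemma congp_prod n (I : Type) (r : seq I) (P : pred I) (f g : I -> Zp) :
    (forall i, P i -> congp n (f i) (g i)) ->
  congp n (\prod_(i <- r | P i) f i) (\prod_(i <- r | P i) g i).
Proof. by move=> fg; apply: (big_ind2 (congp n)) => // *; apply: congpM. Qed.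

Lemma congp0P n x : congp n x 0 <-> exists y, x = p%:R ^+ n * y.
Proof.
rewrite /congp residue0; split=> [x0|[y ->]]; last first.
  by rewrite -natrX residueM padic_natE /= modnn mul0n mod0n.
have xdvd m : (p ^ n %| residue x (m + n))%N.
  by rewrite /dvdn -residue_leq ?leq_addl // x0.
(* Division by p^n loses n digits, so the quotient mod p^m is read off from the residue of x at
   level m + n. *)
have yP m : (residue x (m.+1 + n) %/ p ^ n = residue x (m + n) %/ p ^ n %[mod p ^ m])%N.
  apply/eqP; rewrite -(eqn_pmul2r (pX_gt0 n)) !muln_modl ?pX_gt0 //.
  rewrite !divnK // -expnD -!residue_leq //; lia.
exists (padic_of p_pr yP); apply: residue_inj => m.
rewrite -natrX residueM padic_natE /= modnMml modnMmr.
have [nm|mn] := leqP n m.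
  rewrite [in RHS]mulnC divnK // -residue_leq; lia.
rewrite (residue_leq _ (ltnW mn)) x0 mod0n; apply/esym/eqP.
by rewrite -/(_ %| _)%N dvdn_mulr // dvdn_exp2l // ltnW.
Qed.

Lemma congpE n x y : congp n x y <-> congp n (x - y) 0.
Proof.
split=> [xy|xy]; first by rewrite -(subrr y); apply: congpB.
by rewrite -[x](subrK y) -[in X in congp _ _ X](add0r y); apply: congpD.
Qed.

Lemma congp_subr n x y : congp n x y -> congp n (x - y) 0.
Proof. by rewrite congpE. Qed.

Lemma congpP n x y : congp n x y <-> exists z, x = y + p%:R ^+ n * z.
Proof.
rewrite congpE congp0P; split=> -[z E]; exists z; first by rewrite -E addrC subrK.
by rewrite E addrAC subrr add0r.
Qed.

Lemma congp_residue n x : congp n (residue x n)%:R x.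
Proof. by rewrite /congp padic_natE /= residue_small. Qed.

Lemma congp_nat n (a b : nat) : congp n a%:R b%:R <-> (a = b %[mod p ^ n])%N.
Proof. by rewrite /congp !padic_natE. Qed.

Lemma padic_eqP x y : (forall n, congp n x y) -> x = y.
Proof. exact: residue_inj. Qed.

Lemma padic_natr_eq0 a : (a%:R == 0 :> Zp) = (a == 0%N).
Proof.
apply/eqP/eqP => [a0|->//].
have : congp a a%:R 0 by rewrite a0.
by rewrite /congp padic_natE residue0 /= modn_small // ltn_expl.
Qed.

Lemma pdvdP x : pdvd x <-> congp 1 x 0.
Proof. by rewrite congp0P expr1. Qed.

Lemma unit_congp x : x \is a GRing.unit -> ~ congp 1 x 0.
Proof.
move=> ux x0; have : congp 1 1 0.
  by rewrite -(mulVr ux) -[X in congp _ _ X](mulr0 x^-1); apply: congpM.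
by rewrite /congp residue0 -[1]/(1%:R) padic_natE /= expn1 modn_small.
Qed.

(** Dividing by a costs v_p(a) digits of precision, uniformly in x. This later controls the
    denominators n! of the binomials. *)
Lemma congp_cancel a : (0 < a)%N ->
  exists v, forall N x, congp (N + v) (a%:R * x) 0 -> congp N x 0.
Proof.
move=> a_gt0; exists (logn p a) => N x.
rewrite /congp !residue0 residueM padic_natE /= modnMml => /eqP.
rewrite (residue_leq x (leq_addr (logn p a) N)).
move: (residue x _) => b; rewrite -/(_ %| _)%N => H; apply/eqP; rewrite -/(_ %| _)%N.
have [->|b_gt0] := posnP b; first by rewrite dvdn0.
move: H; rewrite !pfactor_dvdn ?muln_gt0 ?a_gt0 // lognM //; lia.
Qed.

Definition converges (u : nat -> Zp) x :=
  forall n, exists M, forall N, (M <= N)%N -> congp n (u N) x.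

Lemma converges_unique u x y : converges u x -> converges u y -> x = y.
Proof.
move=> ux uy; apply: padic_eqP => n.
have [M MP] := ux n; have [M' MP'] := uy n.
by rewrite /congp -(MP (maxn M M')) ?leq_maxl // MP' // leq_maxr.
Qed.

Lemma padic_complete u :
  (forall n, exists M, forall N, (M <= N)%N -> congp n (u N) (u M)) ->
  exists x, converges u x.
Proof.
move=> /choice[f fP].
(* The limit has at level n the residue of u at the rank [f n] from which u is constant mod p^n. *)
have xP n : (residue (u (f n.+1)) n.+1 = residue (u (f n)) n %[mod p ^ n])%N.
  rewrite residueS; congr (_ %% _)%N.
  rewrite -(fP n (maxn (f n) (f n.+1))) ?leq_maxl //.
  by apply/esym/(congp_leq (leqnSn n))/fP; rewrite leq_maxr.
exists (padic_of p_pr xP) => n; exists (f n) => N /fP E.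
by rewrite /congp E /= residue_small.
Qed.

Lemma lim_converges u x : converges u x -> lim (u n @[n --> \oo])%classic = x.
Proof.
move=> ux; have H : (u n @[n --> \oo] --> x)%classic.
  apply/cvg_padicP => m; have [M MP] := ux m.
  by exists M => // N /= MN; apply: MP.
have /cvg_padicP H' : (u n @[n --> \oo] --> lim (u n @[n --> \oo]))%classic.
  exact: (cvgP _ H).
apply: converges_unique ux => m.
by have [M _ MP] := H' m; exists M => N MN; apply: MP.
Qed.

End Residues.

(** * The characters omega and <x> *)

Section Powers.
Variables (p : nat) (p_pr : prime p).
Local Notation Zp := (padic_int p_pr).
Implicit Types (x y s t : Zp) (m n N : nat).

(** In x^p - y^p = (x - y) S, the sum S is congruent to p y^(p-1), hence to 0, modulo p; this gains
    one more power of p. *)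
Lemma congp_expp n x y : (0 < n)%N -> congp n x y -> congp n.+1 (x ^+ p) (y ^+ p).
Proof.
move=> n_gt0 xy; have /congpE/congp0P[z Ez] := xy.
apply/congpE; rewrite subrXX Ez.
suff /congp0P[t ->] : congp 1 (\sum_(i < p) x ^+ (p.-1 - i) * y ^+ i) 0.
  by apply/congp0P; exists (z * t); rewrite expr1 mulrACA exprSr.
have xy1 : congp 1 x y by apply: congp_leq xy.
apply: (@congp_trans _ _ _ _ (\sum_(i < p) y ^+ p.-1)).
  apply: congp_sum => i _; have ip : (i <= p.-1)%N by have := ltn_ord i; lia.
  rewrite -[X in congp _ _ (_ ^+ X)](subnK ip) exprD.
  by apply: congpM => //; apply: congpX.
rewrite sumr_const card_ord; apply/congp0P.
by exists (y ^+ p.-1); rewrite expr1 mulr_natl.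
Qed.

Lemma congp_exp_ppow n x y : congp 1 x y -> congp n.+1 (x ^+ (p ^ n)) (y ^+ (p ^ n)).
Proof.
move=> xy; elim: n => [|n IHn]; first by rewrite !expr1.
by rewrite expnSr !exprM; apply: congp_expp.
Qed.

Lemma congp_exp_mod n (a b : nat) y :
  congp 1 y 1 -> (a = b %[mod p ^ n])%N -> congp n (y ^+ a) (y ^+ b).
Proof.
move=> y1.
suff H c : congp n (y ^+ c) (y ^+ (c %% p ^ n)) by rewrite /congp (H a) (H b) => ->.
rewrite {1}(divn_eq c (p ^ n)) mulnC exprD exprM -[X in congp _ _ X]mul1r.
apply: congpM => //; rewrite -(expr1n _ (c %/ p ^ n)); apply: congpX.
by apply: (congp_leq (leqnSn n)); rewrite -(expr1n _ (p ^ n)); apply: congp_exp_ppow.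
Qed.

(** For y = 1 mod p, the class of y^m mod p^n depends only on m mod p^n. The sequence defining y^s
    is therefore constant mod p^n from rank n on. *)
Lemma pow_padicE n y s : congp 1 y 1 -> congp n (pow_padic y s) (y ^+ residue s n).
Proof.
move=> y1; have H m N : (m <= N)%N -> congp m (y ^+ residue s N) (y ^+ residue s m).
  by move=> mN; apply: congp_exp_mod => //; rewrite (residue_leq s mN) modn_mod.
have [x ux] : exists x, converges (fun n => y ^+ residue s n) x.
  by apply: padic_complete => m; exists m => N; apply: H.
rewrite /pow_padic (lim_converges ux).
have [M MP] := ux n; rewrite /congp -(MP (maxn M n)) ?leq_maxl //.
by apply: H; rewrite leq_maxr.
Qed.

Lemma pow_padicD y s t :
  congp 1 y 1 -> pow_padic y (s + t) = pow_padic y s * pow_padic y t.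
Proof.
move=> y1; apply: padic_eqP => n.
apply: (congp_trans (pow_padicE _ _ y1)); apply: congp_sym.
apply: (congp_trans (congpM (pow_padicE _ _ y1) (pow_padicE _ _ y1))).
by rewrite -exprD; apply: congp_exp_mod; rewrite // residueD modn_mod.
Qed.

Lemma pow_padic0 y : congp 1 y 1 -> pow_padic y 0 = 1.
Proof.
move=> y1; apply: padic_eqP => n; apply: (congp_trans (pow_padicE _ _ y1)).
by rewrite residue0.
Qed.

Lemma pow_padic_sum (I : Type) (r : seq I) (P : pred I) (f : I -> Zp) y :
    congp 1 y 1 ->
  pow_padic y (\sum_(i <- r | P i) f i) = \prod_(i <- r | P i) pow_padic y (f i).
Proof.
by move=> y1; apply: big_morph => [s t|]; [exact: pow_padicD | exact: pow_padic0].
Qed.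

Lemma congp_pow_padic n y y' s :
  congp 1 y 1 -> congp n.+1 y y' -> congp n.+1 (pow_padic y s) (pow_padic y' s).
Proof.
move=> y1 yy'; have y'1 : congp 1 y' 1.
  by apply: congp_trans y1; apply/congp_sym/(congp_leq _ yy').
apply: (congp_trans (pow_padicE _ _ y1)); apply: congp_sym.
by apply: (congp_trans (pow_padicE _ _ y'1)); apply: congpX.
Qed.

Lemma congp1_expp x : congp 1 (x ^+ p) x.
Proof.
apply: (@congp_trans _ _ _ _ ((residue x 1)%:R ^+ p)).
  by apply/congpX/congp_sym/congp_residue.
apply: congp_trans (congp_residue 1 x).
by rewrite -natrX; apply/congp_nat; rewrite expn1 fermat_little.
Qed.

(** The representative is the limit of x^(p^n): it is Cauchy because x^p = x mod p and each p-th
    power improves a congruence by one digit. *)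
Lemma teichmuller_exists x : exists w : Zp, congp 1 w x /\ w ^+ p = w.
Proof.
have step n : congp n.+1 (x ^+ (p ^ n.+1)) (x ^+ (p ^ n)).
  by rewrite expnS exprM; apply: congp_exp_ppow; apply: congp1_expp.
have cauchy n N : (n <= N)%N -> congp n.+1 (x ^+ (p ^ N)) (x ^+ (p ^ n)).
  elim: N => [|N IHN]; first by rewrite leqn0 => /eqP ->.
  rewrite leq_eqVlt => /predU1P[-> //|]; rewrite ltnS => nN.
  exact: congp_trans (congp_leq _ (step N)) (IHN nN).
have [w wP] : exists w, converges (fun n => x ^+ (p ^ n)) w.
  apply: padic_complete => n; exists n => N nN.
  by apply: (congp_leq (leqnSn n)); apply: cauchy.
exists w; split.
  have [M MP] := wP 1%N; apply: congp_trans (cauchy 0 M _) => //.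
  by apply/congp_sym/MP.
apply: padic_eqP => n; have [M MP] := wP n.
apply: (@congp_trans _ _ _ _ (x ^+ (p ^ (maxn M n)) ^+ p)).
  by apply/congpX/congp_sym/MP; rewrite leq_maxl.
rewrite -exprM -expnSr; apply: MP.
by rewrite (leq_trans (leq_maxl M n)).
Qed.

Definition q_exp : nat := if p == 2 then 2 else 1.

Lemma q_ofE : q_of p = (p ^ q_exp)%N.
Proof. by rewrite /q_of /q_exp; case: eqP => [->|]; rewrite ?expn1. Qed.

Lemma group_W_unit w : group_W w -> w \is a @GRing.unit Zp.
Proof.
rewrite /group_W /=; case: eqP => [_|_ []//].
by move=> [->|->]; rewrite ?unitrN unitr1.
Qed.

Lemma group_WN w : group_W w -> group_W (- w : Zp).
Proof.
rewrite /group_W /=; case: eqP => [_ [] ->|/eqP p2 [uw w1]].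
- by right.
- by left; rewrite opprK.
split; first by rewrite unitrN.
rewrite exprNn w1 mulr1 -signr_odd.
have [/eqP|op] := even_prime p_pr; first by rewrite (negPf p2).
by rewrite (_ : odd p.-1 = false) //; have := prime_gt0 p_pr; lia.
Qed.

(** For p = 2, the elements 1 and -1 differ mod 4. For odd p, w = w^(p^n), and p^n-th powers turn a
    congruence mod p into one mod p^(n+1). *)
Lemma group_W_congp w w' : group_W w -> group_W w' -> congp q_exp w w' -> w = w' :> Zp.
Proof.
rewrite /group_W /q_exp /=; case: eqP => [p2|p2].
  have two : ~ congp 2 (1 : Zp) (-1).
    move=> /congpE; rewrite opprK -mulr2n -[1 *+ 2]/(2%:R).
    by rewrite /congp residue0 padic_natE /= p2.
  by move=> [->|->] [->|->] // E; case: (two (congp_sym E)).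
have wX w0 n : w0 \is a GRing.unit /\ w0 ^+ p.-1 = 1 -> w0 ^+ (p ^ n) = w0 :> Zp.
  move=> [_ w01]; elim: n => [//|n IHn].
  rewrite expnS exprM -[X in w0 ^+ X](prednK (prime_gt0 p_pr)).
  by rewrite exprS w01 mulr1.
move=> wP w'P ww'; apply: padic_eqP => n.
rewrite -(wX w n) // -(wX w' n) //; apply: (congp_leq (leqnSn n)).
exact: congp_exp_ppow.
Qed.

(** Only existence is at stake: for p = 2 an odd number is 1 or -1 mod 4, and for odd p the
    Teichmuller representative serves. Since w is a unit, a congruence mod q becomes a factor in 1 +
    q Z_p. *)
Lemma omega_spec x : ~ congp 1 x 0 ->
  group_W (omega x) /\ exists y, x = omega x * (1 + (q_of p)%:R * y).
Proof.
move=> x0; rewrite /omega.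
suff H : exists w, group_W w /\ exists y, x = w * (1 + (q_of p)%:R * y).
  exact: (xgetPex 1 H).
have [w [wW /congpP[z Ez]]] : exists w : Zp, group_W w /\ congp q_exp x w.
  rewrite /group_W /q_exp /=; case: eqP => [p2|p2].
    have : residue x 2 = 1%N \/ residue x 2 = 3%N.
      have := residue_lt x 2; move: x0; rewrite /congp residue0.
      rewrite (@residue_leq _ _ _ 1 2) //; move: (residue x 2) => a; rewrite p2.
      by case: a => [|[|[|[|]]]] //=; auto.
    move=> [Ex|Ex]; [exists 1|exists (-1)]; split; auto.
      by rewrite /congp Ex -[1]/(1%:R) padic_natE /= p2.
    apply/congpE; rewrite opprK; apply: congp_trans (_ : congp 2 (3%:R + 1) 0).
      by apply: congpD => //; rewrite /congp Ex padic_natE /= p2.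
    by rewrite natr1 /congp residue0 padic_natE /= p2.
  have [w [wx wp]] := teichmuller_exists x; exists w; split; last exact/congp_sym.
  have w0 : w != 0 by apply/eqP => w0; apply: x0; rewrite -w0; apply/congp_sym.
  have w1 : w ^+ p.-1 = 1.
    apply: (mulfI w0); rewrite mulr1 -exprS prednK //; exact: prime_gt0.
  split=> //; apply/unitrP; exists (w ^+ p.-2).
  have p1 : p.-2.+1 = p.-1 by have := prime_gt1 p_pr; lia.
  by rewrite -exprS -exprSr p1.
exists w; split=> //; exists (w^-1 * z).
rewrite Ez q_ofE natrX mulrDr mulr1; congr (_ + _).
by rewrite [RHS]mulrCA mulVKr // group_W_unit.
Qed.

Lemma congp_q_exp y : congp q_exp (1 + (q_of p)%:R * y) (1 : Zp).
Proof. by apply/congpP; exists y; rewrite q_ofE natrX. Qed.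

Lemma congp_omega x : ~ congp 1 x 0 -> congp q_exp (omega x) x.
Proof.
move=> /omega_spec[_ [y Ey]]; rewrite [X in congp _ _ X]Ey -[X in congp _ X _]mulr1.
by apply: congpM => //; apply/congp_sym/congp_q_exp.
Qed.

Lemma omegaN x : ~ congp 1 x 0 -> omega (- x) = - omega x.
Proof.
move=> x0; have Nx0 : ~ congp 1 (- x) 0.
  by move=> H; apply: x0; rewrite -[x]opprK -[X in congp _ _ X]oppr0; apply: congpN.
apply: group_W_congp; [by case: (omega_spec Nx0) | |].
  by apply: group_WN; case: (omega_spec x0).
by apply: (congp_trans (congp_omega Nx0)); apply/congpN/congp_sym/congp_omega.
Qed.

Lemma q_exp_le2 : (q_exp <= 2)%N. Proof. by rewrite /q_exp; case: ifP. Qed.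

(** Congruent arguments satisfy the same defining predicate, so [xget] returns the same value, also
    at non-units. The modulus p^2 covers both q = 4 and q = p. *)
Lemma omega_congp x x' : congp 2 x x' -> omega x = omega x'.
Proof.
move=> xx'.
have sub y y' : congp q_exp y y' -> forall w : Zp,
    (group_W w /\ exists z, y' = w * (1 + (q_of p)%:R * z)) ->
    (group_W w /\ exists z, y = w * (1 + (q_of p)%:R * z)).
  move=> /congpP[t ->] w [wW [z ->]]; split=> //.
  have [v ->] : exists v, t = w * v by exists (w^-1 * t); rewrite mulVKr // group_W_unit.
  by exists (z + v); rewrite q_ofE natrX; ring.
have q_xx' := congp_leq q_exp_le2 xx'.
rewrite /omega; congr xget; apply/funext => w; apply/propext.
by split; apply: sub => //; apply: congp_sym.
Qed.

Lemma omega_unit x : ~ congp 1 x 0 -> omega x \is a GRing.unit.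
Proof. by move=> /omega_spec[/group_W_unit]. Qed.

Lemma angle1 x : ~ congp 1 x 0 -> congp 1 (angle x) 1.
Proof.
move=> x0; have [wW [y Ey]] := omega_spec x0.
rewrite /angle {1}Ey [omega x * _]mulrC mulrK ?group_W_unit //.
by apply: (@congp_leq _ _ _ q_exp _ _ _ (congp_q_exp y)); rewrite /q_exp; case: ifP.
Qed.

Lemma angleN x : ~ congp 1 x 0 -> angle (- x) = angle x.
Proof. by move=> x0; rewrite /angle omegaN // invrN mulrNN. Qed.

Lemma congp_angle n x x' : congp n.+2 x x' -> congp n.+2 (angle x) (angle x').
Proof.
move=> xx'; rewrite /angle (@omega_congp x x'); first exact: congpM.
exact: congp_leq xx'.
Qed.

End Powers.

(** * Binomial coefficients *)

Section Binomials.
Variables (p : nat) (p_pr : prime p).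
Local Notation Zp := (padic_int p_pr).
Implicit Types (x y : Zp) (u v : nat -> Zp) (m n N : nat).

Lemma converges_congp u v x :
    (forall m, exists M, forall N, (M <= N)%N -> congp m (u N) (v N)) ->
  converges u x -> converges v x.
Proof.
move=> uv ux n; have [M MP] := ux n; have [M' M'P] := uv n.
exists (maxn M M') => N; rewrite geq_max => /andP[MN M'N].
exact: congp_trans (congp_sym (M'P _ M'N)) (MP _ MN).
Qed.

Lemma converges_cst x : converges (fun=> x) x.
Proof. by move=> n; exists 0%N. Qed.

Lemma convergesD u v x y :
  converges u x -> converges v y -> converges (fun N => u N + v N) (x + y).
Proof.
move=> ux vy n; have [M MP] := ux n; have [M' M'P] := vy n.
exists (maxn M M') => N; rewrite geq_max => /andP[MN M'N].
by apply: congpD; auto.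
Qed.

Lemma convergesM u v x y :
  converges u x -> converges v y -> converges (fun N => u N * v N) (x * y).
Proof.
move=> ux vy n; have [M MP] := ux n; have [M' M'P] := vy n.
exists (maxn M M') => N; rewrite geq_max => /andP[MN M'N].
by apply: congpM; auto.
Qed.

Lemma converges_sum (I : Type) (r : seq I) (P : pred I) (f : I -> nat -> Zp) (g : I -> Zp) :
    (forall i, converges (f i) (g i)) ->
  converges (fun N => \sum_(i <- r | P i) f i N) (\sum_(i <- r | P i) g i).
Proof.
move=> fg; elim: r => [|i r IHr].
  by move=> n; exists 0%N => N _; rewrite !big_nil.
have -> : (fun N => \sum_(j <- i :: r | P j) f j N) =
    fun N => (if P i then f i N else 0) + \sum_(j <- r | P j) f j N.
  by apply/funext => N; rewrite big_cons; case: (P i); rewrite ?add0r.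
have -> : \sum_(j <- i :: r | P j) g j =
    (if P i then g i else 0) + \sum_(j <- r | P j) g j.
  by rewrite big_cons; case: (P i); rewrite ?add0r.
by apply: convergesD => //; case: (P i) => //; apply: converges_cst.
Qed.

Lemma ffact_natr a n : (a ^_ n)%:R = \prod_(i < n) (a%:R - i%:R) :> Zp.
Proof.
elim: n => [|n IHn]; first by rewrite big_ord0.
rewrite ffactnSr natrM IHn big_ord_recr /=.
have [na|an] := leqP n a; first by rewrite natrB.
by rewrite -IHn ffact_small // !mul0r.
Qed.

Lemma congp_fact_cancel n m : exists N0, forall x, congp N0 (n`!%:R * x) 0 -> congp m x 0.
Proof. by have [v H] := congp_cancel p_pr (fact_gt0 n); exists (m + v)%N => x; apply: H. Qed.

Lemma congp_ffact N n x y :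
  congp N x y -> congp N (\prod_(i < n) (x - i%:R)) (\prod_(i < n) (y - i%:R)).
Proof. by move=> xy; apply: congp_prod => i _; apply: congpB. Qed.

(** The quotient is the limit of the integers binom(a, n) for a the residues of x: their multiples
    by n! are values of a polynomial, and cancelling n! costs boundedly many digits. *)
Lemma binomial_padicP x n : n`!%:R * binomial_padic x n = \prod_(i < n) (x - i%:R).
Proof.
rewrite /binomial_padic.
suff H : exists b, n`!%:R * b = \prod_(i < n) (x - i%:R) by exact: (xgetPex 0 H).
pose u N : Zp := ('C(residue x N, n))%:R.
have uE N : n`!%:R * u N = \prod_(i < n) ((residue x N)%:R - i%:R).
  by rewrite -natrM mulnC bin_ffact ffact_natr.
have [b ub] : exists b, converges u b.
  apply: padic_complete => m; have [N0 H] := congp_fact_cancel n m.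
  exists N0 => N N0N; apply/congpE/H; rewrite mulrBr; apply: congp_subr.
  rewrite !uE; apply: congp_ffact; apply: congp_trans (congp_sym (congp_residue _ _)).
  by apply: (congp_leq N0N); apply: congp_residue.
exists b; apply: (converges_unique (u := fun N => n`!%:R * u N)).
  by apply: convergesM => //; apply: converges_cst.
by move=> m; exists m => N mN; rewrite uE; apply: congp_ffact; apply: (congp_leq mN);
  apply: congp_residue.
Qed.

Lemma fact_natr_neq0 n : n`!%:R != 0 :> Zp.
Proof. by rewrite padic_natr_eq0 -lt0n fact_gt0. Qed.

Lemma binomial_padic_nat a n : binomial_padic a%:R n = 'C(a, n)%:R :> Zp.
Proof.
apply: (mulfI (fact_natr_neq0 n)).
by rewrite binomial_padicP -ffact_natr -natrM mulnC bin_ffact.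
Qed.

Lemma congp_binomial n m : exists N0, forall x y,
  congp N0 x y -> congp m (binomial_padic x n) (binomial_padic y n).
Proof.
have [N0 H] := congp_fact_cancel n m; exists N0 => x y xy.
by apply/congpE/H; rewrite mulrBr !binomial_padicP; apply/congp_subr/congp_ffact.
Qed.

Lemma converges_binomial x n :
  converges (fun N => binomial_padic (residue x N)%:R n) (binomial_padic x n).
Proof.
move=> m; have [N0 H] := congp_binomial n m; exists N0 => N N0N.
by apply: H; apply: (congp_leq N0N); apply: congp_residue.
Qed.

(** Vandermonde's identity for natural numbers, extended by density and continuity. *)
Lemma binomial_padicD x y n :
  binomial_padic (x + y) n =
  \sum_(i < n.+1) binomial_padic x i * binomial_padic y (n - i).
Proof.
apply: (converges_unique (u := fun N => \sum_(i < n.+1)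
    binomial_padic (residue x N)%:R i * binomial_padic (residue y N)%:R (n - i))); last first.
  by apply: converges_sum => i; apply: convergesM; apply: converges_binomial.
move=> m; have [N0 H] := congp_binomial n m; exists N0 => N N0N.
under eq_bigr => i _ do rewrite !binomial_padic_nat -natrM.
rewrite -natr_sum binomial.Vandermonde -binomial_padic_nat natrD; apply: H.
by apply: congpD; apply: (congp_leq N0N); apply: congp_residue.
Qed.

End Binomials.

(** * Distributions on Z_p *)

Section Distributions.
Variables (p : nat) (p_pr : prime p).
Local Notation Zp := (padic_int p_pr).
Implicit Types (x y : Zp) (F G : nat -> Zp -> Zp) (g h : pseries Zp) (m n N : nat).

(* [F N x] is the mass of the ball x + p^N Z_p; balls are indexed by their
   p-adic centres so that translations and x |-> -x act without reduction. *)
Definition distribution F :=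
  (forall N x y, congp N x y -> F N x = F N y) /\
  (forall N x, F N x = \sum_(i < p ^ N.+1 | residue (i%:R : Zp) N == residue x N) F N.+1 i%:R).

Lemma residue_ord N (i : 'I_(p ^ N)) : residue (i%:R : Zp) N = i.
Proof. by rewrite padic_natE /= modn_small. Qed.

Lemma congp_ord_inj N (i j : 'I_(p ^ N)) : congp N (i%:R : Zp) j%:R -> i = j.
Proof. by rewrite /congp ![residue _%:R _]residue_ord => /val_inj. Qed.

(** A map that preserves and reflects congruence mod p^N permutes the residue classes. *)
Lemma sum_residues_reindex N (f : Zp -> Zp) (h : Zp -> Zp) :
    (forall x y, congp N x y -> f x = f y) ->
    (forall x y, congp N (h x) (h y) <-> congp N x y) ->
  \sum_(i < p ^ N) f (h i%:R) = \sum_(i < p ^ N) f i%:R.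
Proof.
move=> fP hP; pose k (i : 'I_(p ^ N)) : 'I_(p ^ N) := Ordinal (residue_lt (h i%:R) N).
have k_inj : injective k.
  by move=> i j /(congr1 val) /= /hP; apply: congp_ord_inj.
rewrite [RHS](reindex k); last by apply: onW_bij; apply: injF_bij.
by apply: eq_bigr => i _; apply: fP; apply/congp_sym; apply: congp_residue.
Qed.

Lemma congp_addr N x y z : congp N (x - z) (y - z) <-> congp N x y.
Proof.
split=> [H|H]; last exact: congpB.
by rewrite -[x](subrK z) -[y](subrK z); apply: congpD.
Qed.

Lemma congp_opp N x y : congp N (- x) (- y) <-> congp N x y.
Proof.
split=> H; last exact: congpN.
by rewrite -[x]opprK -[y]opprK; apply: congpN.
Qed.

Lemma distribution_comp F (h : Zp -> Zp) :
    (forall N x y, congp N (h x) (h y) <-> congp N x y) ->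
  distribution F -> distribution (fun N x => F N (h x)).
Proof.
move=> hP [F1 F2]; split=> [N x y xy|N x]; first by apply: F1; apply/hP.
(* The ball condition is folded into a function constant mod p^(N+1), to which the permutation of
   classes by h applies. *)
pose f z := if residue z N == residue (h x) N then F N.+1 z else 0.
have fP z z' : congp N.+1 z z' -> f z = f z'.
  by move=> zz'; rewrite /f (congp_leq (leqnSn N) zz') (F1 _ _ _ zz').
rewrite F2 big_mkcond /= -/(f _) [RHS]big_mkcond.
rewrite -[LHS](sum_residues_reindex fP (hP N.+1)).
apply: eq_bigr => i _; rewrite /f; congr (if _ then _ else _).
by apply/eqP/eqP => [/hP|] // H; apply/hP.
Qed.

Lemma distribution_shift F y : distribution F -> distribution (fun N x => F N (x - y)).
Proof. by apply: distribution_comp => N a b; apply: congp_addr. Qed.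

Lemma distribution_opp F : distribution F -> distribution (fun N x => F N (- x)).
Proof. by apply: distribution_comp => N a b; apply: congp_opp. Qed.

Lemma distributionD F G :
  distribution F -> distribution G -> distribution (fun N x => F N x + G N x).
Proof.
move=> [F1 F2] [G1 G2]; split=> [N x y xy|N x]; first by rewrite (F1 _ _ _ xy) (G1 _ _ _ xy).
by rewrite F2 G2 -big_split.
Qed.

Lemma distributionZ F a : distribution F -> distribution (fun N x => a * F N x).
Proof.
move=> [F1 F2]; split=> [N x y xy|N x]; first by rewrite (F1 _ _ _ xy).
by rewrite F2 mulr_sumr.
Qed.

Lemma distributionB F G :
  distribution F -> distribution G -> distribution (fun N x => F N x - G N x).
Proof.
move=> dF dG; have := distributionD dF (distributionZ (-1) dG).
by congr distribution; apply/funext => N; apply/funext => x; rewrite mulN1r.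
Qed.

Definition dirac0 N x : Zp := (residue x N == 0%N)%:R.

Lemma dirac0N N x : dirac0 N (- x) = dirac0 N x.
Proof.
have H (z : Zp) : residue z N = 0%N <-> congp N z 0 by rewrite /congp residue0.
rewrite /dirac0; congr (nat_of_bool _)%:R; apply/eqP/eqP => /H E; apply/H.
  by apply/congp_opp; rewrite oppr0.
by rewrite -[X in congp _ _ X]oppr0; apply: congpN.
Qed.

Lemma distribution_dirac0 : distribution dirac0.
Proof.
split=> [N x y xy|N x]; first by rewrite /dirac0 xy.
have pos : (0 < p ^ N.+1)%N by rewrite expn_gt0 prime_gt0.
rewrite big_mkcond (bigD1 (Ordinal pos)) //= big1 => [|i i0].
  rewrite addr0 /dirac0 !residue0 mod0n eqxx eq_sym.
  by case: eqP.
case: ifP => // _; rewrite /dirac0 [residue _%:R _]residue_ord.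
by move: i0; rewrite -val_eqE /= => /negbTE ->.
Qed.

Lemma distribution_refine F N M x : distribution F -> (N <= M)%N ->
  F N x = \sum_(i < p ^ M | residue (i%:R : Zp) N == residue x N) F M i%:R.
Proof.
move=> [F1 F2].
have F_N : F N x = \sum_(i < p ^ N | residue (i%:R : Zp) N == residue x N) F N i%:R.
  pose i0 : 'I_(p ^ N) := Ordinal (residue_lt x N).
  rewrite (big_pred1 i0) => [|i]; first by apply/F1/congp_sym/congp_residue.
  by rewrite [residue _%:R _]residue_ord.
elim: M => [|M IHM]; first by rewrite leqn0 => /eqP N0; move: F_N; rewrite {}N0.
rewrite leq_eqVlt => /predU1P[<- //|].
rewrite ltnS => NM; rewrite (IHM NM).
pose k (j : 'I_(p ^ M.+1)) : 'I_(p ^ M) := Ordinal (residue_lt (j%:R : Zp) M).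
have kE (j : 'I_(p ^ M.+1)) : residue ((k j)%:R : Zp) N = residue (j%:R : Zp) N.
  by apply: (congp_leq NM); apply: congp_residue.
rewrite [RHS](partition_big k (fun i => residue (i%:R : Zp) N == residue x N)); last first.
  by move=> j; rewrite kE.
apply: eq_bigr => i /eqP iP; rewrite F2; apply: eq_bigl => j.
rewrite [residue i%:R M]residue_ord -val_eqE /= -iP andbC; case: eqP => //= E.
by rewrite -(kE j) /= E eqxx.
Qed.

(* An invariant distribution gives the mass p^-M F(Z_p) to each ball of level M,
   so its total mass is divisible by every power of p. *)
Lemma distribution_invariant0 F a : a \is a GRing.unit -> distribution F ->
  (forall N x, F N (x - a) = F N x) -> forall N x, F N x = 0.
Proof.
move=> ua dF Finv; have [F1 _] := dF.
have Fnat N x k : F N (x - k%:R * a) = F N x.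
  elim: k => [|k IHk]; first by rewrite mul0r subr0.
  by rewrite -natr1 mulrDl mul1r opprD addrA Finv.
(* As a is a unit, x is congruent mod p^N to the natural multiple k a with k the residue of x /
   a. *)
have Fcst N x : F N x = F N 0.
  rewrite -(Fnat _ x (residue (x / a) N)); apply: F1.
  rewrite -(subrr x); apply: congpB => //; rewrite -[X in congp _ _ X](divrK ua).
  by apply: congpM => //; apply: congp_residue.
have mass M : F 0%N 0 = (p ^ M)%:R * F M 0.
  rewrite (distribution_refine 0 dF (leq0n M)) (eq_bigl xpredT) => [|i].
    rewrite (eq_bigr (fun=> F M 0)) => [|i _]; last exact: Fcst.
    by rewrite sumr_const card_ord mulr_natl.
  by rewrite (residue_leq i%:R (leq0n M)) expn0 !modn1 residue0.
have F00 : F 0%N 0 = 0.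
  by apply: padic_eqP => M; apply/congp0P; exists (F M 0); rewrite -natrX -mass.
move=> N x; rewrite Fcst; apply: (mulfI (x := (p ^ N)%:R)); last by rewrite mulr0 -mass F00.
by rewrite padic_natr_eq0 expn_eq0 -leqn0 leqNgt prime_gt0.
Qed.

(* int (1 + T)^x dF = g *)
Definition has_series F g :=
  forall n, converges (fun N => \sum_(a < p ^ N) binomial_padic a%:R n * F N a%:R) (g n).

Lemma ps_const_mulE a g n : (ps_const a * g) n = a * g n.
Proof.
rewrite [LHS]big_ord_recl /= subn0 big1 ?addr0 // => i _.
by rewrite /ps_const /= mul0r.
Qed.

Lemma has_seriesZ F g a : has_series F g -> has_series (fun N x => a * F N x) (ps_const a * g).
Proof.
move=> Fg n; rewrite ps_const_mulE.
have := convergesM (converges_cst a) (Fg n); congr converges.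
by apply/funext => N; rewrite mulr_sumr; apply: eq_bigr => b _; rewrite mulrCA.
Qed.

Lemma has_seriesB F G g h : has_series F g -> has_series G h ->
  has_series (fun N x => F N x - G N x) (g - h).
Proof.
move=> Fg Gh n; have := convergesD (Fg n) (convergesM (converges_cst (-1)) (Gh n)).
have -> : (g - h) n = g n + -1 * h n by rewrite mulN1r.
congr converges; apply/funext => N; rewrite mulr_sumr -big_split; apply: eq_bigr => a _ /=.
by ring.
Qed.

Lemma has_series_dirac0 : has_series dirac0 1.
Proof.
move=> n m; exists 0%N => N _.
have pos : (0 < p ^ N)%N by rewrite expn_gt0 prime_gt0.
rewrite (bigD1 (Ordinal pos)) //= big1 => [|i i0].
  rewrite addr0 /dirac0 residue0 eqxx mulr1 (binomial_padic_nat p_pr 0) bin0n.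
  have -> : (1 : pseries Zp) n = (n == 0%N)%:R.
    by rewrite [LHS]/(ps_const 1 n) /ps_const; case: (n == 0%N).
  by [].
rewrite /dirac0 [residue _%:R _]residue_ord.
by move: i0; rewrite -val_eqE /= => /negbTE ->; rewrite mulr0.
Qed.

(** This is (1 + T)^(x + y) = (1 + T)^y (1 + T)^x under the integral, coefficientwise the addition
    formula for binomials. *)
Lemma has_series_shift F g y : distribution F -> has_series F g ->
  has_series (fun N x => F N (x - y)) (one_plus_T_pow y * g).
Proof.
move=> [F1 _] Fg n.
have cv := converges_sum (index_enum 'I_n.+1) xpredT
  (fun i : 'I_n.+1 => convergesM (converges_cst (binomial_padic y i)) (Fg (n - i)%N)).
apply: converges_congp cv => m.
have [N0 H] := congp_binomial p_pr n m; exists N0 => N N0N; apply: congp_sym.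
(* Using the residue of z makes f a function of the class mod p^N; on 0, ..., p^N - 1 it is the
   original summand. *)
pose f (z : Zp) := binomial_padic (residue z N)%:R n * F N (z - y).
have fP z z' : congp N z z' -> f z = f z'.
  move=> zz'; rewrite /f zz' (F1 N (z - y) (z' - y)) //; exact: congpB.
have hP z z' : congp N (z + y) (z' + y) <-> congp N z z'.
  by have := congp_addr N z z' (- y); rewrite opprK.
rewrite (eq_bigr (fun a : 'I_(p ^ N) => f a%:R)); last first.
  by move=> a _; rewrite /f [residue _%:R _]residue_ord.
rewrite -(sum_residues_reindex fP hP) /f.
under [X in congp _ _ X]eq_bigr => i _ do rewrite mulr_sumr.
rewrite exchange_big /=; apply: congp_sum => a _; rewrite addrK.
under eq_bigr => i _ do rewrite mulrA.
rewrite -mulr_suml -binomial_padicD [y + _]addrC; apply: congpM => //.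
by apply: H; apply: (congp_leq N0N); apply: (congp_residue N (a%:R + y)).
Qed.

End Distributions.

(** * Mahler's theorem *)

Section FrobeniusModP.
Variables (R : comNzRingType) (p : nat) (p_pr : prime p).

Lemma exprD_prime (u v : R) : exists w, (u + v) ^+ p = u ^+ p + v ^+ p + p%:R * w.
Proof.
have p0 := prime_gt0 p_pr.
rewrite exprDn (bigD1 ord0) //= (bigD1 ord_max) /=; last by rewrite -val_eqE /= -lt0n.
rewrite subn0 subnn !expr0 mulr1 mul1r bin0 binn !mulr1n.
suff [w ->] : exists w, \sum_(i < p.+1 | (i != ord0) && (i != ord_max))
    u ^+ (p - i) * v ^+ i *+ 'C(p, i) = p%:R * w by exists w; rewrite addrA.
apply: (big_ind (fun t => exists w, t = p%:R * w)) => [|_ _ [a ->] [b ->]|i /andP[i0 ip]].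
- by exists 0; rewrite mulr0.
- by exists (a + b); rewrite mulrDr.
have /dvdnP[k ->] : (p %| 'C(p, i))%N.
  apply: prime_dvd_bin => //; move: i0 ip; rewrite -!val_eqE /=; have := ltn_ord i; lia.
by exists (u ^+ (p - i) * v ^+ i * k%:R); rewrite -mulr_natr natrM; ring.
Qed.

Lemma exprD_ppow (u v : R) N : exists w,
  (u + v) ^+ (p ^ N) = u ^+ (p ^ N) + v ^+ (p ^ N) + p%:R * w.
Proof.
elim: N => [|N [w IHw]]; first by exists 0; rewrite mulr0 addr0 !expr1.
rewrite expnSr !exprM IHw.
have [a ->] := exprD_prime (u ^+ (p ^ N) + v ^+ (p ^ N)) (p%:R * w).
have [b ->] := exprD_prime (u ^+ (p ^ N)) (v ^+ (p ^ N)).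
exists (b + w * (p%:R * w) ^+ p.-1 + a).
have -> : (p%:R * w) ^+ p = p%:R * (w * (p%:R * w) ^+ p.-1).
  by rewrite mulrA -exprS prednK // prime_gt0.
by rewrite !mulrDr -!addrA.
Qed.

Lemma exprD_divl (u v : R) n : exists w, (u + v) ^+ n = u * w + v ^+ n.
Proof.
have /eqP := subrXX (u + v) v n; rewrite subr_eq addrK => /eqP ->.
by eexists.
Qed.

End FrobeniusModP.

Section Mahler.
Variables (p : nat) (p_pr : prime p).
Local Notation Zp := (padic_int p_pr).

(** The linear form sending X^i to h i; it sends (X - 1)^n to the n-th finite difference of h at
    0. *)
Definition coef_form (h : nat -> Zp) (P : {poly Zp}) : Zp := \sum_(i < size P) P`_i * h i.

Lemma coef_formE h (P : {poly Zp}) K : (size P <= K)%N ->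
  coef_form h P = \sum_(i < K) P`_i * h i.
Proof.
move=> PK; rewrite /coef_form (big_ord_widen K (fun i => P`_i * h i)) //.
rewrite big_mkcond; apply: eq_bigr => i _; case: ltnP => // Pi.
by rewrite nth_default // mul0r.
Qed.

Lemma coef_formD h (P Q : {poly Zp}) : coef_form h (P + Q) = coef_form h P + coef_form h Q.
Proof.
pose K := maxn (size P) (size Q).
rewrite !(@coef_formE _ _ K) ?leq_maxl ?leq_maxr ?size_polyD //.
by rewrite -big_split; apply: eq_bigr => i _; rewrite coefD mulrDl.
Qed.

Lemma coef_formZ h a (P : {poly Zp}) : coef_form h (a *: P) = a * coef_form h P.
Proof.
rewrite !(@coef_formE _ _ (size P)) ?size_scale_leq // mulr_sumr.
by apply: eq_bigr => i _; rewrite coefZ mulrA.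
Qed.

Lemma coef_form_sum h (I : Type) (r : seq I) (P : I -> {poly Zp}) :
  coef_form h (\sum_(i <- r) P i) = \sum_(i <- r) coef_form h (P i).
Proof.
elim: r => [|i r IHr]; last by rewrite !big_cons coef_formD IHr.
by rewrite !big_nil /coef_form size_poly0 big_ord0.
Qed.

Lemma coef_formXn h n : coef_form h 'X^n = h n.
Proof.
rewrite (@coef_formE _ _ n.+1) ?size_polyXn // big_ord_recr /= coefXn eqxx mul1r.
by rewrite big1 ?add0r // => i _; rewrite coefXn ltn_eqF ?mul0r.
Qed.

Lemma coef_formXnM h m (P : {poly Zp}) : (forall i, h (m + i)%N = h i) ->
  coef_form h ('X^m * P) = coef_form h P.
Proof.
move=> hm; rewrite (@coef_formE _ _ (m + size P)); last first.
  by apply: leq_trans (size_polyMleq _ _) _; rewrite size_polyXn.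
rewrite big_split_ord /= big1 ?add0r => [|i _]; last first.
  by rewrite coefXnM ltn_ord mul0r.
by apply: eq_bigr => i _; rewrite coefXnM ltnNge leq_addr /= addKn hm.
Qed.

(* Delta^n h 0 for n >= M p^N is divisible by p^M if h has period p^N, because
   (X - 1)^(p^N) = X^(p^N) - 1 mod p. *)
Lemma newton_expansion (h : nat -> Zp) : exists lam : nat -> Zp,
  (forall a K, (a < K)%N -> h a = \sum_(n < K) 'C(a, n)%:R * lam n) /\
  (forall N M n, (forall i, h (p ^ N + i)%N = h i) -> (M * p ^ N <= n)%N -> congp M (lam n) 0).
Proof.
pose T : {poly Zp} := 'X - 1.
exists (fun n => coef_form h (T ^+ n)); split=> [a K aK|N M n hN].
  (* Newton's formula is the binomial expansion of X^a = (T + 1)^a under the form. *)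
  rewrite -{1}(coef_formXn h a) -[X in X ^+ a](subrK 1) -/T exprD1n coef_form_sum.
  rewrite -(subnKC aK) big_split_ord /= [X in _ + X]big1 ?addr0 => [|i _]; last first.
    by rewrite bin_small ?mul0r // ltn_addr.
  by apply: eq_bigr => i _; rewrite -scaler_nat coef_formZ.
move=> /subnKC <-; rewrite exprD.
have [w wE] := exprD_ppow p_pr T 1 N.
have {wE} TE : T ^+ (p ^ N) = ('X^(p ^ N) - 1) - p%:R * w.
  by move: wE; rewrite subrK expr1n => ->; ring.
(* In the M-th power of (X^(p^N) - 1) - p w, all terms but (- p w)^M contain X^(p^N) - 1, which the
   form kills by periodicity. *)
have [S SE] := exprD_divl ('X^(p ^ N) - 1) (- (p%:R * w)) M.
rewrite mulnC exprM TE {}SE mulrDl coef_formD -mulrA mulrBl mul1r coef_formD.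
rewrite -scaleN1r coef_formZ mulN1r coef_formXnM // subrr add0r.
rewrite -mulrN exprMn -natrX -mulrA mulr_natl -scaler_nat coef_formZ natrX.
by apply/congp0P; eexists.
Qed.

(** Newton coefficients from rank M p^N on vanish mod p^M, so one truncation serves for all a. *)
Lemma mahler_approx (h : nat -> Zp) N M : (forall i, h (p ^ N + i)%N = h i) ->
  exists D (lam : nat -> Zp), forall a, congp M (h a) (\sum_(n < D) 'C(a, n)%:R * lam n).
Proof.
move=> hN; have [lam [lamE lam0]] := newton_expansion h.
exists (M * p ^ N)%N, lam => a; set D := (M * _)%N.
rewrite (lamE a (D + a.+1)%N (leq_addl _ _)) big_split_ord /=.
rewrite -[X in congp _ _ X]addr0; apply: congpD => //.
apply: congp_sum0 => n _; rewrite -[X in congp _ _ X](mulr0 ('C(a, (D + n)%N)%:R)).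
by apply: congpM => //; apply: (lam0 N) => //; rewrite leq_addr.
Qed.

(** The indicator of a ball is periodic, hence modulo p^M a finite combination of binomials, whose
    integrals vanish. So each mass is 0 modulo every p^M. *)
Lemma has_series_inj0 (F : nat -> Zp -> Zp) :
  distribution F -> has_series F 0 -> forall N x, F N x = 0.
Proof.
move=> dF F0 N x; apply: padic_eqP => M.
pose h (a : nat) : Zp := (residue (a%:R : Zp) N == residue x N)%:R.
have hN i : h (p ^ N + i)%N = h i.
  by rewrite /h !padic_natE /= modnDl.
have [D [lam lamE]] := mahler_approx M hN.
have cv := converges_sum (index_enum 'I_D) xpredT
  (fun n : 'I_D => convergesM (converges_cst (lam n)) (F0 n)).
have [M' M'P] := cv M; set N' := maxn M' N.
have := M'P N' (leq_maxl _ _); rewrite [X in congp _ _ X]big1 => [|n _]; last exact: mulr0.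
apply: congp_trans.
rewrite (distribution_refine x dF (leq_maxr M' N)) -/N' big_mkcond /=.
apply: (@congp_trans _ _ _ _ (\sum_(i < p ^ N') \sum_(n < D) 'C(i, n)%:R * lam n * F N' i%:R)).
  apply: congp_sum => i _.
  have -> : (if residue (i%:R : Zp) N == residue x N then F N' i%:R else 0) = h i * F N' i%:R.
    by rewrite /h; case: eqP; rewrite ?mul1r ?mul0r.
  by rewrite -mulr_suml; apply: congpM.
rewrite exchange_big /=; apply: congp_sum => n _; rewrite mulr_sumr.
apply: congp_sum => i _; rewrite binomial_padic_nat.
by rewrite mulrA [lam n * _]mulrC.
Qed.

End Mahler.

(** * Riemann sums and the reflection of m_c *)

Section Riemann.
Variables (p : nat) (p_pr : prime p).
Local Notation Zp := (padic_int p_pr).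
Variable mu : padic_measure p_pr.

Definition ball_mass N (x : Zp) : Zp := mu N (Ordinal (residue_lt x N)).

Lemma ball_massE N (i : 'I_(p ^ N)) : mu N i = ball_mass N i%:R.
Proof. by congr (ball_measure mu); apply: val_inj; rewrite /= [residue _%:R _]residue_ord. Qed.

Lemma distribution_ball_mass : distribution ball_mass.
Proof.
split=> [N x y xy|N x]; first by congr (ball_measure mu); apply: val_inj.
rewrite /ball_mass ball_measureS; apply: eq_big => [i|i _]; last exact: ball_massE.
by rewrite padic_natE.
Qed.

Definition padic_ucontinuous rho (f : ('I_rho -> Zp) -> Zp) :=
  forall m, exists N0, forall x y, (forall j, congp N0 (x j) (y j)) -> congp m (f x) (f y).

(** Grouping fine boxes by the coarse box containing them, additivity of the measure leaves only the
    variation of f inside a box, which is 0 mod p^m. *)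
Lemma riemann_sum_congp rho (f : ('I_rho -> Zp) -> Zp) m N0 :
    (forall x y, (forall j, congp N0 (x j) (y j)) -> congp m (f x) (f y)) ->
  forall N, (N0 <= N)%N -> congp m (riemann_sum mu f N) (riemann_sum mu f N0).
Proof.
move=> fP; elim=> [|N IHN]; first by rewrite leqn0 => /eqP ->.
rewrite leq_eqVlt => /predU1P[-> //|]; rewrite ltnS => N0N.
apply: congp_trans (IHN N0N).
have lt_mod (i : nat) : (i %% p ^ N < p ^ N)%N by rewrite ltn_mod expn_gt0 prime_gt0.
pose k (a : {ffun 'I_rho -> 'I_(p ^ N.+1)}) : {ffun 'I_rho -> 'I_(p ^ N)} :=
  [ffun j => Ordinal (lt_mod (a j))].
rewrite /riemann_sum [X in congp _ X _](partition_big k xpredT) //.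
apply: congp_sum => b _; under [X in congp _ _ (_ * X)]eq_bigr => j _ do rewrite ball_measureS.
rewrite bigA_distr_big_dep mulr_sumr.
rewrite [X in congp _ _ X](eq_bigl (fun a => k a == b)) => [|a]; last first.
  apply/familyP/eqP => [H|<- j]; last by rewrite ffunE unfold_in.
  by apply/ffunP => j; apply: val_inj; rewrite ffunE /=; apply/eqP/(H j).
apply: congp_sum => a /eqP <-; apply: congpM => //; apply: fP => j.
by apply: (congp_leq N0N); rewrite ffunE; apply/congp_nat; rewrite modn_mod.
Qed.

Lemma riemann_sum_converges rho (f : ('I_rho -> Zp) -> Zp) : padic_ucontinuous f ->
  converges (riemann_sum mu f) (integral_padic mu f).
Proof.
move=> fP; suff [l ul] : exists l, converges (riemann_sum mu f) l.
  by rewrite /integral_padic (lim_converges ul).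
apply: padic_complete => m; have [N0 H] := fP m; exists N0.
exact: riemann_sum_congp.
Qed.

Lemma has_series_measure : has_series ball_mass (measure_series mu).
Proof.
move=> n; pose f (x : 'I_1 -> Zp) := binomial_padic (x ord0) n.
have fP : padic_ucontinuous f.
  by move=> m; have [N0 H] := congp_binomial p_pr n m; exists N0 => x y xy; apply: H.
have := riemann_sum_converges fP; congr converges; apply/funext => N.
pose k (i : 'I_(p ^ N)) : {ffun 'I_1 -> 'I_(p ^ N)} := [ffun=> i].
rewrite /riemann_sum (reindex k) /=; last first.
  exists (fun a => a ord0) => [i _|a _]; first by rewrite ffunE.
  by apply/ffunP => j; rewrite ffunE (ord1 j).
by apply: eq_bigr => i _; rewrite big_ord1 /f !ffunE ball_massE.
Qed.

End Riemann.

Lemma clear_denominators (K : fieldType) (a b d : K) : a != 0 -> d != 0 ->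
  (1 / a - b / d) * a * d = d - b * a.
Proof. by move=> a0 d0; field; rewrite ?a0 ?d0. Qed.

(** Here [e1] and [ec] stand for 1 + T and (1 + T)^c, whose products with g are the transforms of
    the translates by 1 and c. The product relation thus becomes one between translates. *)
Lemma moment_relation (R : comNzRingType) (e1 ec g w : R) : g * (e1 - 1) * (ec - 1) = w ->
  ec * (e1 * g) - e1 * g - (ec * g - g) - w = 0.
Proof. by move=> <-; ring. Qed.

Lemma reflection_step (R : comNzRingType) (c : R) (F D : R -> R) :
    (forall x, D (- x) = D x) ->
    (forall x, F (x - c - 1) - F (x - 1) - (F (x - c) - F x) =
               D (x - c) - D x - c * (D (x - 1) - D x)) ->
  let nu x := F x + F (- x) - (c - 1) * D x in
  forall x, nu (x - 1 - c) - nu (x - 1) = nu (x - c) - nu x.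
Proof.
move=> DN rel nu x; rewrite /nu.
(* The map x |-> c + 1 - x takes the four points x, x - 1, x - c, x - 1 - c to their negatives in
   another order; the sum of both relations is the double difference of [nu]. *)
have := rel (c + 1 - x).
have -> : c + 1 - x - c - 1 = - x by ring.
have -> : c + 1 - x - 1 = - (x - c) by ring.
have -> : c + 1 - x - c = - (x - 1) by ring.
have -> : c + 1 - x = - (x - 1 - c) by ring.
have := rel x; rewrite !DN [x - c - 1]addrAC.
move: (F x) (F (x - 1)) (F (x - c)) (F (x - 1 - c)) => f1 f2 f3 f4.
move: (F (- x)) (F (- (x - 1))) (F (- (x - c))) (F (- (x - 1 - c))) => f5 f6 f7 f8.
move: (D x) (D (x - 1)) (D (x - c)) (D (x - 1 - c)) => d1 d2 d3 d4.
move=> /eqP; rewrite -subr_eq0 => /eqP r1 /eqP; rewrite -subr_eq0 => /eqP r2.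
apply/eqP; rewrite -subr_eq0; apply/eqP.
by rewrite -[RHS](addr0 0) -{1}r1 -r2; ring.
Qed.

(** * The reflection formula for distributions with transform g_c *)

Section Reflection.
Variables (p : nat) (p_pr : prime p).
Local Notation Zp := (padic_int p_pr).
Variable c : Zp.
Hypothesis c_unit : c \is a GRing.unit.

Lemma one_plus_T_pow1 : one_plus_T_pow (1 : Zp) = 1 + ps_T Zp.
Proof.
apply/funext => n.
have -> : (1 + ps_T Zp) n = (n == 0%N)%:R + (n == 1%N)%:R.
  by congr (_ + _); rewrite [LHS]/(ps_const 1 n) /ps_const; case: (n == 0%N).
rewrite /one_plus_T_pow -[1]/(1%:R) binomial_padic_nat.
by case: n => [|[|n]]; rewrite ?bin0 ?binn ?bin_small ?addr0 ?add0r.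
Qed.

Lemma one_plus_T_pow_neq1 : one_plus_T_pow c != 1.
Proof.
apply/eqP => /(congr1 (@^~ 1%N)) E.
have c0 : c = 0.
  have := binomial_padicP c 1; rewrite mul1r big_ord1 subr0 => <-.
  by rewrite -[LHS]/(one_plus_T_pow c 1) E.
by move: c_unit; rewrite c0 unitr0.
Qed.

Lemma g_series_relation (g : pseries Zp) :
    g%:F = 1 / ((1 + ps_T Zp)%:F - 1)
           - (ps_const c)%:F / ((one_plus_T_pow c)%:F - 1) ->
  g * (one_plus_T_pow 1 - 1) * (one_plus_T_pow c - 1) =
  one_plus_T_pow c - 1 - ps_const c * (one_plus_T_pow 1 - 1).
Proof.
rewrite -one_plus_T_pow1 => gE; apply/eqP; rewrite -tofrac_eq; apply/eqP.
have e1 : (one_plus_T_pow (1 : Zp))%:F - 1 != 0.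
  rewrite -tofrac1 -tofracB tofrac_eq0 one_plus_T_pow1 addrAC subrr add0r.
  by apply/eqP => /(congr1 (@^~ 1%N)) /eqP; rewrite oner_eq0.
have ec : (one_plus_T_pow c)%:F - 1 != 0.
  by rewrite -tofrac1 -tofracB tofrac_eq0 subr_eq0 one_plus_T_pow_neq1.
by rewrite !(tofracM, tofracB, tofrac1) gE clear_denominators.
Qed.

(** Injectivity of the transform turns the series relation into one between masses. By
    [reflection_step] the difference of [nu] under translation by c is invariant under translation
    by 1, hence zero; then [nu] is invariant under the unit c, hence zero. *)
Lemma distribution_reflection (F : nat -> Zp -> Zp) (g : pseries Zp) :
    distribution F -> has_series F g ->
    g * (one_plus_T_pow 1 - 1) * (one_plus_T_pow c - 1) =
      one_plus_T_pow c - 1 - ps_const c * (one_plus_T_pow 1 - 1) ->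
  forall N x, F N x + F N (- x) = (c - 1) * dirac0 N x.
Proof.
move=> dF sF gE.
have d0 := distribution_dirac0 p_pr; have s0 := has_series_dirac0 p_pr.
have rel N x : F N (x - c - 1) - F N (x - 1) - (F N (x - c) - F N x) =
    dirac0 N (x - c) - dirac0 N x - c * (dirac0 N (x - 1) - dirac0 N x).
  apply/eqP; rewrite -subr_eq0; apply/eqP; move: N x.
  have dF1 := distribution_shift 1 dF.
  have sF1 := has_series_shift 1 dF sF.
  apply: has_series_inj0.
    apply: distributionB; apply: distributionB.
    - by apply: distributionB => //; apply: (distribution_shift c dF1).
    - by apply: distributionB => //; apply: distribution_shift.
    - by apply: distributionB => //; apply: distribution_shift.
    - by apply: distributionZ; apply: distributionB => //; apply: distribution_shift.
  have := has_seriesB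
    (has_seriesB (has_seriesB (has_series_shift c dF1 sF1) sF1)
                 (has_seriesB (has_series_shift c dF sF) sF))
    (has_seriesB (has_seriesB (has_series_shift c d0 s0) s0)
       (has_seriesZ c (has_seriesB (has_series_shift 1 d0 s0) s0))).
  by rewrite !mulr1 (moment_relation gE).
pose nu N x := F N x + F N (- x) - (c - 1) * dirac0 N x.
have dnu : distribution nu.
  apply: distributionB; last exact: distributionZ.
  by apply: distributionD => //; apply: distribution_opp.
have nu_rel N := reflection_step (@dirac0N p p_pr N) (rel N).
have eta0 N x : nu N (x - c) - nu N x = 0.
  move: N x; apply: (@distribution_invariant0 _ _ _ 1 (unitr1 _)).
    by apply: distributionB => //; apply: distribution_shift.
  by move=> N x; apply: nu_rel.
have nu0 N x : nu N x = 0.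
  move: N x; apply: (distribution_invariant0 c_unit dnu) => N x.
  by apply/eqP; rewrite -subr_eq0 eta0.
by move=> N x; apply/eqP; rewrite -subr_eq0; apply/eqP; apply: nu0.
Qed.

End Reflection.

(** * The integrand *)

Section MTilde.
Variables (p : nat) (p_pr : prime p).
Local Notation Zp := (padic_int p_pr).

(* The second alternative absorbs the default values of xget in g_series and m_tilde,
   so that neither g_c nor the measure has to be constructed. *)
Lemma m_tilde_reflection (c : Zp) : c \is a GRing.unit ->
  (forall N x, ball_mass (m_tilde c) N x + ball_mass (m_tilde c) N (- x) = (c - 1) * dirac0 N x) \/
  (forall N x, ball_mass (m_tilde c) N x = 0).
Proof.
move=> c_unit; rewrite /m_tilde; case: xgetP => [mu _ muE|_]; last by right.
have d := distribution_ball_mass mu; have := has_series_measure mu.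
rewrite muE /g_series; case: xgetP => [g _ /(g_series_relation c_unit) gE|_] s.
  by left; apply: distribution_reflection gE.
by right; apply: has_series_inj0.
Qed.

(** With x = w u, w in W and u = 1 mod p, the inverse of u is its p-adic power of exponent -1. *)
Lemma padic_unitE (x : Zp) : ~ congp 1 x 0 -> x \is a GRing.unit.
Proof.
move=> x0; have [wW [y ->]] := omega_spec x0; set u := 1 + _.
have u1 : congp 1 u 1 by apply: (congp_leq _ (congp_q_exp y)); rewrite /q_exp; case: ifP.
rewrite unitrM group_W_unit //; apply/unitrP; exists (pow_padic u (-1)).
rewrite [u * _]mulrC; suff E : pow_padic u (-1) * u = 1 by [].
have {2}-> : u = pow_padic u 1.
  apply: padic_eqP => n; apply: congp_sym; apply: (congp_trans (pow_padicE _ _ u1)).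
  rewrite -[X in congp _ _ X]expr1; apply: congp_exp_mod => //.
  by rewrite -[1]/(1%:R) padic_natE /= modn_mod.
by rewrite -pow_padicD // addNr pow_padic0.
Qed.

(** For p = 2 the unit c is odd, so 1 - c is even; for odd p, 2 is a unit. Hence (1 - c)/2 lies in
    Z_p. *)
Lemma half_one_sub (c : Zp) : c \is a GRing.unit -> exists d, 2%:R * d = 1 - c.
Proof.
move=> uc; have [p2|podd] := even_prime p_pr.
  have c1 : congp 1 1 c.
    have := unit_congp uc; rewrite /congp residue0 -[1]/(1%:R) padic_natE /=.
    by have := residue_lt c 1; move: (residue c 1) => a; rewrite p2; case: a => [|[|]].
  have /congpE/congp0P[z ->] := c1; exists z; congr (_ * z); rewrite expr1.
  by apply: (congr1 (fun a => a%:R : Zp)); rewrite p2.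
have u2 : (2%:R : Zp) \is a GRing.unit.
  apply: padic_unitE; rewrite /congp residue0 padic_natE /= expn1.
  case: p podd (prime_gt1 p_pr) => [|[|[|q]]] //=.
by exists (2%:R^-1 * (1 - c)); rewrite mulVKr.
Qed.

End MTilde.

Section Integrand.
Variables (p : nat) (p_pr : prime p) (rho : nat).
Local Notation Zp := (padic_int p_pr).
Variables (s gam : 'I_rho -> Zp) (k : 'I_rho -> int).
Implicit Types x y : 'I_rho -> Zp.

Definition L_fun := patch (fun=> 0) (L_domain gam) (L_integrand s k gam).

Lemma L_domainP x : L_domain gam x <-> forall i, ~ congp 1 (partial_sum gam x i) 0.
Proof. by split=> H i; [move=> /pdvdP | move=> /pdvdP]; apply: H. Qed.

Lemma L_fun_in x : L_domain gam x -> L_fun x = L_integrand s k gam x.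
Proof. by move=> /mem_set xD; rewrite /L_fun /patch xD. Qed.

Lemma L_fun_out x : ~ L_domain gam x -> L_fun x = 0.
Proof. by move=> xD; rewrite /L_fun /patch memNset. Qed.

Lemma congp_partial_sum n x y i :
  (forall j, congp n (x j) (y j)) -> congp n (partial_sum gam x i) (partial_sum gam y i).
Proof. by move=> xy; apply: congp_sum => j _; apply: congpM. Qed.

Lemma L_fun_ucontinuous : padic_ucontinuous L_fun.
Proof.
(* The domain depends on x mod p and [omega] on its argument mod p^2, so precision m + 2 suffices
   for all factors. *)
move=> m; exists m.+2 => x y xy.
have dom u v : (forall j, congp m.+2 (u j) (v j)) -> L_domain gam u -> L_domain gam v.
  move=> uv /L_domainP uD; apply/L_domainP => i v0; apply: (uD i).
  by apply: congp_trans v0; apply: congp_partial_sum => j; apply: congp_leq (uv j).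
have [xD|xD] := pselect (L_domain gam x); last first.
  rewrite !L_fun_out // => yD; apply: xD; apply: dom yD => j; exact/congp_sym.
have yD := dom _ _ xy xD; rewrite (L_fun_in xD) (L_fun_in yD).
apply: congp_prod => i _; have xyi := congp_partial_sum i xy.
have omE : omega (partial_sum gam x i) = omega (partial_sum gam y i).
  by apply: omega_congp; apply: congp_leq xyi.
apply: congpM; last by rewrite omE.
apply: (congp_leq (leq_trans (leqnSn m) (leqnSn _))); apply: congp_pow_padic.
  by apply: angle1; apply: (proj1 (L_domainP x) xD).
exact: congp_angle.
Qed.

Lemma partial_sumN x i : partial_sum gam (fun j => - x j) i = - partial_sum gam x i.
Proof. by rewrite -sumrN; apply: eq_bigr => j _; rewrite mulNr. Qed.

(** The factor <x> is even and [omega] is odd, so the i-th factor contributes (-1)^(k_i); the domain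
    is symmetric. *)
Lemma L_funN x : L_fun (fun j => - x j) = (-1) ^ (\sum_i k i) * L_fun x.
Proof.
have domN u : L_domain gam u -> L_domain gam (fun j => - u j).
  move=> /L_domainP uD; apply/L_domainP => i; rewrite partial_sumN => u0; apply: (uD i).
  by apply/congp_opp; rewrite oppr0.
have [xD|xD] := pselect (L_domain gam x); last first.
  rewrite !L_fun_out ?mulr0 // => /domN; congr (~ L_domain gam _): xD.
  by apply/funext => j; rewrite opprK.
rewrite !L_fun_in //; last exact: domN.
have -> : (-1 : Zp) ^ (\sum_i k i) = \prod_i (-1) ^ k i.
  apply: (big_morph (fun z : int => (-1 : Zp) ^ z)) => // a b.
  by rewrite exprzDr // unitrN1.
rewrite -big_split; apply: eq_bigr => i _ /=.
have P0 := proj1 (L_domainP x) xD i.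
rewrite partial_sumN angleN // omegaN // -[- omega _]mulN1r exprzMl ?unitrN1 ?omega_unit //.
by rewrite mulrCA.
Qed.

End Integrand.

(** * Partial sums on the blocks of J *)

Section Blocks.
Variables (r : nat) (J : {set 'I_r}).

Lemma jseqE (i : 'I_#|J|) : jseq J i = enum_val i.
Proof.
rewrite /jseq (nth_map (enum_val i)) -?cardE //.
by congr (nat_of_ord _); apply: set_nth_default; rewrite -cardE.
Qed.

Lemma jseq_card : jseq J #|J| = r.
Proof. by rewrite /jseq nth_default // size_map cardE. Qed.

Lemma jseq_lt m n : (m < n)%N -> (n <= #|J|)%N -> (jseq J m < jseq J n)%N.
Proof.
move=> mn nJ; have mJ := leq_trans mn nJ.
move: nJ; rewrite leq_eqVlt => /predU1P[->|nJ].
  by rewrite jseq_card (jseqE (Ordinal mJ)).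
have srt : sorted ltn [seq val j | j <- enum J].
  apply: (subseq_sorted ltn_trans) (iota_ltn_sorted 0 r).
  by rewrite -val_enum_ord map_subseq // enumT; apply: filter_subseq.
by apply: (sorted_ltn_nth ltn_trans) => //; rewrite inE size_map -cardE.
Qed.

Lemma jseq_le m n : (m <= n)%N -> (n <= #|J|)%N -> (jseq J m <= jseq J n)%N.
Proof.
rewrite leq_eqVlt => /predU1P[-> //|mn] nJ; exact/ltnW/jseq_lt.
Qed.

(** The block of l starts at the largest element of J that is at most l, which exists because 0 is
    in J. *)
Lemma block_exists (i0 : 'I_r) : val i0 = 0%N -> i0 \in J ->
  forall l : 'I_r, exists mu : 'I_#|J|, (jseq J mu <= l < jseq J mu.+1)%N.
Proof.
move=> i00 i0J l; pose mu0 := enum_rank_in i0J i0.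
have mu0P : (jseq J mu0 <= l)%N by rewrite jseqE enum_rankK_in // -/(val i0) i00.
case: (@arg_maxnP _ mu0 (fun mu : 'I_#|J| => (jseq J mu <= l)%N) (fun mu => mu) mu0P).
move=> mu /= muP max_mu; exists mu; rewrite muP ltnNge; apply/negP => Smu.
have muJ : (mu.+1 < #|J|)%N.
  rewrite ltn_neqAle ltn_ord andbT; apply/eqP => E.
  by move: Smu; rewrite E jseq_card leqNgt ltn_ord.
by have := max_mu (Ordinal muJ) Smu; rewrite /= ltnn.
Qed.

Lemma block_le (mu : 'I_#|J|) (l : 'I_r) : (jseq J mu <= l < jseq J mu.+1)%N ->
  forall nu : 'I_#|J|, (enum_val nu <= l)%N = (nu <= mu)%N.
Proof.
move=> /andP[mul lmu] nu; rewrite -jseqE; apply/idP/idP => [nul|numu].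
  rewrite leqNgt; apply/negP => munu.
  have := leq_trans lmu (jseq_le munu (ltnW (ltn_ord nu))).
  by rewrite ltnNge nul.
by apply: leq_trans mul; apply: jseq_le => //; apply: ltnW.
Qed.

Lemma block_unique (l : 'I_r) (mu nu : 'I_#|J|) :
  (jseq J mu <= l < jseq J mu.+1)%N -> (jseq J nu <= l < jseq J nu.+1)%N -> mu = nu.
Proof.
move=> muP nuP; apply: val_inj; apply/eqP; rewrite eqn_leq.
rewrite -(block_le nuP) -(block_le muP) -!jseqE.
by case/andP: muP => -> _; case/andP: nuP => -> _.
Qed.

End Blocks.

(** * Restriction of the integrand and of its Riemann sums to the coordinates in J *)

Section Restriction.
Variables (p : nat) (p_pr : prime p) (r : nat).
Local Notation Zp := (padic_int p_pr).
Variables (s gam : 'I_r -> Zp) (k : 'I_r -> int) (i0 : 'I_r).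
Hypothesis i0_0 : val i0 = 0%N.
Implicit Type J : {set 'I_r}.

Lemma L_fun_at0 (x : 'I_r -> Zp) : x i0 = 0 -> L_fun s gam k x = 0.
Proof.
move=> x0; apply: L_fun_out => /L_domainP /(_ i0); apply.
rewrite /partial_sum (big_pred1 i0) ?x0 ?mul0r // => j.
by have /= i00 := i0_0; rewrite i00 leqn0 -i00.
Qed.

(** The partial sum at l only sees the elements of J up to l, hence only the block of l. Factors
    over one block share their base, so their exponents add up. *)
Lemma L_fun_block J (x : 'I_r -> Zp) : i0 \in J -> (forall j, j \notin J -> x j = 0) ->
  L_fun s gam k x =
  L_fun (block_sum J s) (subfamily J gam) (block_sum J k) (fun nu => x (enum_val nu)).
Proof.
move=> i0J x0; have [blk blkP] := fin_all_exists (block_exists i0_0 i0J).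
set xJ := fun nu => x (enum_val nu); set gJ := subfamily J gam.
have psE l : partial_sum gam x l = partial_sum gJ xJ (blk l).
  rewrite /partial_sum (bigID (mem J)) /= [X in _ + X]big1 ?addr0; last first.
    by move=> j /andP[_ jJ]; rewrite x0 ?mul0r.
  rewrite (eq_bigl (fun j => (j \in J) && (j <= l)%N)) => [|j]; last by rewrite andbC.
  rewrite big_enum_val_cond; apply: eq_bigl => nu.
  exact: block_le (blkP l) nu.
(* Every block contains its first element, so the conditions on the blocks all occur among those on
   the indices l. *)
have blk_enum nu : blk (enum_val nu) = nu.
  apply: (block_unique (blkP _)); rewrite -(jseqE nu) leqnn /=.
  by apply: jseq_lt.
have domE : L_domain gam x <-> L_domain gJ xJ.
  split=> H i; last by rewrite psE; apply: H.
  by rewrite -(blk_enum i) -psE; apply: H.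
have [xD|xD] := pselect (L_domain gam x); last first.
  by rewrite !L_fun_out // => /domE.
have xJD := proj1 domE xD; rewrite !L_fun_in // /L_integrand.
rewrite (partition_big blk xpredT) //=; apply: eq_bigr => mu _.
have P0 := proj1 (L_domainP gJ xJ) xJD mu.
have muE l : (blk l == mu) = (jseq J mu <= l < jseq J mu.+1)%N.
  by apply/eqP/idP => [<-|]; [exact: blkP | exact: block_unique (blkP l)].
rewrite /block_sum -sumrN (pow_padic_sum _ _ _ (angle1 P0)).
have -> : omega (partial_sum gJ xJ mu) ^ (\sum_(l < r | (jseq J mu <= l < jseq J mu.+1)%N) k l)
    = \prod_(l < r | (jseq J mu <= l < jseq J mu.+1)%N) omega (partial_sum gJ xJ mu) ^ k l.
  apply: (big_morph (fun z : int => omega (partial_sum gJ xJ mu) ^ z)) => // a b.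
  by rewrite exprzDr // omega_unit.
rewrite -big_split /=; apply: eq_big => l; first exact: muE.
by move=> /eqP <-; rewrite psE.
Qed.

Variables (mu : padic_measure p_pr) (d : Zp).

Lemma riemann_sum_restrict J N : i0 \in J ->
  \sum_(a : {ffun 'I_r -> 'I_(p ^ N)}) L_fun s gam k (fun j => (a j)%:R) *
     \prod_j (if j \in J then ball_mass mu N (a j)%:R else d * dirac0 N (a j)%:R) =
  d ^+ (r - #|J|) *
  riemann_sum mu (L_fun (block_sum J s) (subfamily J gam) (block_sum J k)) N.
Proof.
move=> i0J; have pos : (0 < p ^ N)%N by rewrite expn_gt0 prime_gt0.
pose o : 'I_(p ^ N) := Ordinal pos.
pose P (a : {ffun 'I_r -> 'I_(p ^ N)}) := [forall j, (j \notin J) ==> (a j == o)].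
(* A nonzero index outside J meets a vanishing Dirac mass; the remaining families correspond to
   those indexed by J, extended by 0. *)
rewrite (bigID P) /= [X in _ + X]big1 ?addr0; last first.
  move=> a /forallPn[j]; rewrite negb_imply => /andP[jJ aj].
  rewrite (bigD1 j) //= (negPf jJ) /dirac0 [residue _%:R _]residue_ord.
  by move: aj; rewrite -val_eqE /= => /negPf ->; rewrite !(mulr0, mul0r).
pose ext (b : {ffun 'I_#|J| -> 'I_(p ^ N)}) : {ffun 'I_r -> 'I_(p ^ N)} :=
  [ffun j => if j \in J then b (enum_rank_in i0J j) else o].
pose res (a : {ffun 'I_r -> 'I_(p ^ N)}) : {ffun 'I_#|J| -> 'I_(p ^ N)} :=
  [ffun nu => a (enum_val nu)].
have extE b nu : ext b (enum_val nu) = b nu by rewrite ffunE enum_valP enum_valK_in.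
rewrite (reindex_onto ext res); last first.
  move=> a /forallP aP; apply/ffunP => j; rewrite ffunE; case: ifPn => jJ.
    by rewrite ffunE enum_rankK_in.
  by apply/esym/eqP; apply: (implyP (aP j)).
rewrite (eq_bigl xpredT) => [|b]; last first.
  apply/andP; split; first by apply/forallP => j; apply/implyP => /negPf jJ; rewrite ffunE jJ.
  by apply/eqP/ffunP => nu; rewrite ffunE extE.
rewrite /riemann_sum mulr_sumr; apply: eq_bigr => b _.
rewrite (L_fun_block i0J) => [|j jJ]; last by rewrite ffunE (negPf jJ).
have -> : (fun nu => (ext b (enum_val nu))%:R : Zp) = fun nu => (b nu)%:R.
  by apply/funext => nu; rewrite extE.
rewrite [RHS]mulrCA; apply: congr1.
rewrite (bigID (mem J)) /= mulrC.
rewrite [X in X * _](_ : _ = d ^+ (r - #|J|)); last first.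
  rewrite (eq_bigr (fun=> d)) => [|j jJ]; last first.
    by rewrite (negPf jJ) ffunE (negPf jJ) /dirac0 residue0 eqxx mulr1.
  rewrite prodr_const; congr (_ ^+ _).
  by rewrite -[LHS](addKn #|J|) [X in (X - _)%N](cardC (mem J)) card_ord.
apply: congr1; rewrite (eq_bigr (fun j => ball_mass mu N (ext b j)%:R)) => [|j -> //].
by rewrite big_enum_val; apply: eq_bigr => nu _; rewrite extE ball_massE.
Qed.

End Restriction.

(** * Parity and the expansion over J *)

Section Parity.
Variables (p : nat) (p_pr : prime p) (rho : nat).
Local Notation Zp := (padic_int p_pr).

(** The involution a |-> -a mod p^N gives S = -S mod p^m, only a congruence because the
    representative of -a is merely congruent to -a. The factor 2 stays, since dividing by it would
    lose precision when p = 2. *)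
Lemma odd_integral0 (f : ('I_rho -> Zp) -> Zp) (nu : nat -> Zp -> Zp) (e : Zp) :
    padic_ucontinuous f -> (forall x, f (fun j => - x j) = e * f x) ->
    e * (-1) ^+ rho = -1 ->
    (forall N x y, congp N x y -> nu N x = nu N y) ->
    (forall N x, nu N (- x) = - nu N x) ->
  converges (fun N => 2%:R * \sum_(a : {ffun 'I_rho -> 'I_(p ^ N)})
    f (fun j => (a j)%:R) * \prod_j nu N (a j)%:R) 0.
Proof.
move=> fc fN eE nuc nuN m; have [N0 H] := fc m; exists N0 => N N0N.
set S := \sum_a _; suff SE : congp m S (- S).
  by rewrite mulr_natl mulr2n -[X in congp _ _ X](addNr S); apply: congpD.
pose neg (a : {ffun 'I_rho -> 'I_(p ^ N)}) : {ffun 'I_rho -> 'I_(p ^ N)} :=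
  [ffun j => Ordinal (residue_lt (- (a j)%:R : Zp) N)].
have negE a j : congp N (neg a j)%:R (- (a j)%:R : Zp).
  by rewrite ffunE; apply: (congp_residue N (- (a j)%:R : Zp)).
have negK : involutive neg.
  move=> a; apply/ffunP => j; apply: (@congp_ord_inj _ p_pr).
  apply: (congp_trans (negE _ _)); rewrite -[X in congp _ _ X]opprK.
  by apply: congpN; apply: negE.
rewrite {1}/S (reindex_inj (inv_inj negK)) -sumrN /=; apply: congp_sum => a _.
rewrite (eq_bigr (fun j => - 1 * nu N (a j)%:R)) => [|j _]; last first.
  by rewrite mulN1r -nuN; apply/nuc/negE.
rewrite big_split prodr_const card_ord /=.
apply: (@congp_trans _ _ _ _ (e * f (fun j => (a j)%:R) * ((-1) ^+ rho * \prod_j nu N (a j)%:R))).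
  by apply: congpM => //; rewrite -fN; apply: H => j; apply: (congp_leq N0N).
by rewrite mulrACA eE mulN1r.
Qed.

End Parity.

Lemma exprzN1_odd (R : unitRingType) (z : int) (n : nat) :
  (z != n %[mod 2])%Z -> (-1 : R) ^ z * (-1) ^+ n = -1.
Proof.
move=> zn; rewrite exprnP -exprzDr ?unitrN1 //.
have -> : z + n = 2 * ((z + n) %/ 2)%Z + 1 by lia.
by rewrite exprzDr ?unitrN1 // -exprz_exp -exprnP sqrrN expr1n exp1rz mul1r.
Qed.

(** * Expansion of the odd measure and the relation in Z_p *)

Section Relation.
Variables (p : nat) (p_pr : prime p).
Local Notation Zp := (padic_int p_pr).

Lemma integral_m_tilde_eq0 rho (f : ('I_rho -> Zp) -> Zp) (mu : padic_measure p_pr) :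
  (0 < rho)%N -> (forall N x, ball_mass mu N x = 0) -> integral_padic mu f = 0.
Proof.
case: rho f => // rho f _ mu0; rewrite /integral_padic (@lim_converges _ _ _ 0) //.
move=> m; exists 0%N => N _; apply: congp_sum0 => a _.
by rewrite big_ord_recl ball_massE mu0 mul0r mulr0.
Qed.

(* The term of the full set J is kept over 'I_r, since its indices in 'I_#|J| would
   require a cast. *)
Lemma L_padic_relation (r : nat) (s gam : 'I_r -> Zp) (k : 'I_r -> int) (c d : Zp) (i0 : 'I_r) :
    val i0 = 0%N -> (\sum_(i < r) k i != r %[mod 2])%Z -> c \is a GRing.unit ->
    2%:R * d = 1 - c ->
  L_padic s k gam c + \sum_(J : {set 'I_r} | (J \proper [set: 'I_r]) && (i0 \in J))
    d ^+ (r - #|J|) * L_padic (block_sum J s) (block_sum J k) (subfamily J gam) c = 0.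
Proof.
move=> i00 kr uc dE; pose mu := m_tilde c.
(* If all masses vanish, every term is an integral of positive depth against zero; the depth is
   positive since [i0] lies in J. *)
have [refl|mu0] := m_tilde_reflection uc; last first.
  rewrite /L_padic integral_m_tilde_eq0 ?add0r ?big1 // => [J /andP[_ i0J]|].
    by rewrite integral_m_tilde_eq0 ?mulr0 //; apply/card_gt0P; exists i0.
  exact: leq_ltn_trans (ltn_ord i0).
pose nu N x := ball_mass mu N x + d * dirac0 N x.
have nuc N x y : congp N x y -> nu N x = nu N y.
  by move=> xy; rewrite /nu (proj1 (distribution_ball_mass mu) _ _ _ xy) /dirac0 xy.
have nuN N x : nu N (- x) = - nu N x.
  have E : ball_mass mu N (- x) = (c - 1) * dirac0 N x - ball_mass mu N x.
    by rewrite -refl addrAC subrr add0r.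
  rewrite /nu dirac0N E (_ : c - 1 = - (2%:R * d)); last by rewrite dE opprB.
  by ring.
have := odd_integral0 (@L_fun_ucontinuous _ p_pr _ s gam k) (@L_funN _ p_pr _ s gam k)
  (exprzN1_odd _ kr) nuc nuN.
have expand N : \sum_(a : {ffun 'I_r -> 'I_(p ^ N)})
      L_fun s gam k (fun j => (a j)%:R) * \prod_j nu N (a j)%:R =
    riemann_sum mu (L_fun s gam k) N +
    \sum_(J : {set 'I_r} | (J \proper [set: 'I_r]) && (i0 \in J)) d ^+ (r - #|J|) *
      riemann_sum mu (L_fun (block_sum J s) (subfamily J gam) (block_sum J k)) N.
  (* Expanding the product of sums, J records the coordinates that take the factor [ball_mass]; the
     full set gives the original Riemann sum. *)
  rewrite (eq_bigr _ (fun a _ => congr1 _ (bigA_distr _ _ _ _))).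
  under eq_bigr => a _ do rewrite mulr_sumr.
  rewrite exchange_big /= (bigD1 [set: 'I_r]) //=; congr (_ + _).
    apply: eq_bigr => a _; congr (_ * _); apply: eq_bigr => j _.
    by rewrite inE ball_massE.
  rewrite (bigID (fun J : {set 'I_r} => i0 \in J)) /= [X in _ + X]big1 ?addr0; last first.
    move=> J /andP[_ i0J]; apply: big1 => a _.
    rewrite (bigD1 i0) //= (negPf i0J) /dirac0 [residue _%:R _]residue_ord.
    case: eqP => [ai0|_]; last by rewrite mulr0 mul0r mulr0.
    by rewrite (L_fun_at0 s gam k i00) ?mul0r // ai0.
  apply: eq_big => [J|J /andP[_ i0J]]; first by rewrite properT.
  exact: (riemann_sum_restrict s gam k i00).
have cv : converges (fun N => 2%:R * \sum_(a : {ffun 'I_r -> 'I_(p ^ N)})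
      L_fun s gam k (fun j => (a j)%:R) * \prod_j nu N (a j)%:R)
    (2%:R * (L_padic s k gam c + \sum_(J : {set 'I_r} | (J \proper [set: 'I_r]) && (i0 \in J))
    d ^+ (r - #|J|) * L_padic (block_sum J s) (block_sum J k) (subfamily J gam) c)).
  under eq_fun => N do rewrite expand.
  apply: convergesM; first exact: converges_cst.
  apply: convergesD; first exact/riemann_sum_converges/L_fun_ucontinuous.
  apply: converges_sum => J; apply: convergesM; first exact: converges_cst.
  exact/riemann_sum_converges/L_fun_ucontinuous.
(* The limits give twice the relation, and 2 cancels in the integral domain Z_p even when it is not
   a unit. *)
move=> /(converges_unique cv)/eqP; rewrite mulf_eq0 padic_natr_eq0 /= => /eqP.
exact.
Qed.

End Relation.

Theorem theorem3p15 (p : nat) (p_pr : prime p) (r : nat) (hr : (1 < r)%N)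
    (k : 'I_r -> int) (gam : 'I_r -> padic_int p_pr) (c : padic_int p_pr)
    (s : 'I_r -> padic_int p_pr) :
  (\sum_(i < r) k i != r %[mod 2])%Z ->
  (forall j : 'I_r, (0 < j)%N -> pdvd (gam j)) ->
  c \is a GRing.unit ->
  (L_padic s k gam c)%:F =
  - \sum_(J : {set 'I_r} | (J \proper [set: 'I_r]) && (Ordinal (ltnW hr) \in J))
      ((1 - c%:F) / 2%:R) ^+ (r - #|J|) *
      (L_padic (block_sum J s) (block_sum J k) (subfamily J gam) c)%:F.
Proof.
move=> kr _ uc; have [d dE] := half_one_sub uc.
(* The coefficient is the image of an element of Z_p, so the identity in Q_p is the image of one in
   Z_p. *)
have -> : (1 - c%:F) / 2%:R = d%:F.
  have two0 : (2%:R : {fraction padic_int p_pr}) != 0.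
    by rewrite -tofrac1 -tofracMn tofrac_eq0 padic_natr_eq0.
  apply: (mulIf two0); rewrite divfK // -tofrac1 -tofracB -dE tofracM tofracMn tofrac1.
  by rewrite mulrC.
have /eqP := L_padic_relation s gam (i0 := Ordinal (ltnW hr)) erefl kr uc dE.
rewrite addr_eq0 => /eqP ->; rewrite tofracN; congr (- _).
rewrite (big_morph _ (@tofracD _) (@tofrac0 _)); apply: eq_bigr => J _.
by rewrite tofracM tofracXn.
Qed.
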